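(* Let $\xi$ be a real-valued continuous random variable whose support contains a nonempty open set, and suppose there exists $\tau>0$ such that $$\mathbf{E}|\xi|^{\tau}<\infty\quad\text{and}\quad\sup_{a\in\mathbb{R}}\mathbf{E}|\xi-a|^{-\tau}<\infty.$$ Let $X_1,X_2,\ldots$ be a sequence of i.i.d. $d\times d$ random matrices whose elements are i.i.d. random variables distributed like $\xi$. For every $n$ let $\lambda_1(n),\ldots,\lambda_d(n)$ be the eigenvalues (complex, counted with algebraic multiplicity) and $\sigma_1(n),\ldots,\sigma_d(n)$ the singular values of $X_nX_{n-1}\cdots X_1$, each listed in decreasing order of absolute value. Then for any $r>0$, with probability one, for all $1\le p\le d$, $$\lim_{n\to\infty}\frac{1}{n^r}\log\left(\frac{|\lambda_p(n)|}{\sigma_p(n)}\right)=0.$$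
   Context: ''Continuous random variable'' means that the distribution of $\xi$ has no atoms, i.e. $\mathbf{P}(\xi=x)=0$ for every $x\in\mathbb{R}$. The support of $\xi$ is the set of $x\in\mathbb{R}$ such that $\mathbf{P}(\xi\in O)>0$ for every open neighbourhood $O$ of $x$. The matrices $X_n$ are invertible with probability one, so the expression in the limit is well defined for all $n$ and $p$ outside an event of probability zero. *)

(* Defs.v *)
From HB Require Import structures.
From mathcomp Require Import all_boot all_order all_algebra.
From mathcomp Require Import finmap.
From mathcomp Require Import all_classical all_reals all_analysis.
From mathcomp Require Export complex.

Set Implicit Arguments.
Unset Strict Implicit.
Unset Printing Implicit Defensive.

Import Order.TTheory GRing.Theory Num.Theory.
Import numFieldNormedType.Exports.

Local Open Scope classical_set_scope.
Local Open Scope ring_scope.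

(* Matrices carry the sigma-algebra generated by their entries, as n.-tuple
   does in the library. *)
Definition mx_display : measure_display -> measure_display.
Proof. exact. Qed.

Section measurable_matrix.
Context {d : measure_display} {T : measurableType d}.
Variables m n : nat.

Definition g_sigma_entries : set (set 'M[T]_(m, n)) :=
  <<s \bigcup_(ij in [set: 'I_m * 'I_n])
        preimage_set_system setT (fun A : 'M[T]_(m, n) => A ij.1 ij.2)
          measurable >>.

Let mx_set0 : g_sigma_entries set0.
Proof. exact: sigma_algebra0. Qed.

Let mx_setC A : g_sigma_entries A -> g_sigma_entries (~` A).
Proof. exact: sigma_algebraC. Qed.

Let mx_bigcup (F : (set 'M[T]_(m, n))^nat) :
  (forall i, g_sigma_entries (F i)) -> g_sigma_entries (\bigcup_i (F i)).
Proof. exact: sigma_algebra_bigcup. Qed.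

HB.instance Definition _ := @isMeasurable.Build (mx_display d)
  'M[T]_(m, n) g_sigma_entries mx_set0 mx_setC mx_bigcup.

Lemma measurable_entry (i : 'I_m) (j : 'I_n) :
  measurable_fun [set: 'M[T]_(m, n)] (fun A : 'M[T]_(m, n) => A i j).
Proof.
move=> _ B mB; apply: sub_sigma_algebra; exists (i, j) => //.
by exists B.
Qed.

End measurable_matrix.

Section probability_notions.
Context {d d' : measure_display} {T : measurableType d}
  {T' : measurableType d'} {R : realType} (P : probability T R).

(* Not stated as an equality of pushforwards: P, as a function on all subsets
   of T, is unconstrained outside the sigma-algebra. *)
Definition same_law (Y Z : T -> T') : Prop :=
  forall B : set T', measurable B -> P (Y @^-1` B) = P (Z @^-1` B).

Definition mutually_independent (I : choiceType) (Y : I -> T -> T') : Prop :=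
  forall (J : {fset I}) (B : I -> set T'), (forall i, measurable (B i)) ->
    P (\bigcap_(i in [set` J]) (Y i @^-1` B i)) =
    (\prod_(i <- J) P (Y i @^-1` B i))%E.

Definition iid (I : choiceType) (Y : I -> T -> T') : Prop :=
  mutually_independent Y /\ forall i j, same_law (Y i) (Y j).

End probability_notions.

Section real_random_variable.
Context {d : measure_display} {T : measurableType d} {R : realType}
  (P : probability T R).

(* For atomless xi, the convention 0 `^ (- tau) = 0 in the negative moments
   of xi - a only concerns the null event xi = a. *)
Definition atomless (xi : T -> R) : Prop :=
  forall x : R, P (xi @^-1` [set x]) = 0%E.

Definition law_support (xi : T -> R) : set R :=
  [set x | forall O : set R, open O -> O x -> (0 < P (xi @^-1` O))%E].

End real_random_variable.

Section spectrum.
Context {R : realType}.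
Variable d : nat.
Implicit Types M : 'M[R]_d.

Definition modulus (z : R[i]) : R := ComplexField.Normc.normc z.

Definition complex_char_poly M : {poly R[i]} :=
  char_poly (map_mx (real_complex R) M).

(* Complex roots of the characteristic polynomial with multiplicity, by
   nonincreasing modulus; the order among equal moduli is arbitrary. *)
Definition eigenvalues M : seq R[i] :=
  sort (fun x y => modulus y <= modulus x)
    (sval (closed_field_poly_normal (complex_char_poly M))).

(* The eigenvalues of M^T *m M are nonnegative reals embedded in R[i]. *)
Definition singular_values M : seq R :=
  sort >=%R [seq Num.sqrt (complex.Re z) | z <- eigenvalues (M^T *m M)].

Lemma modulusE (z : R[i]) : `|z| = (modulus z)%:C%C.
Proof. by []. Qed.

Lemma eigenvaluesE M :
  complex_char_poly M = \prod_(z <- eigenvalues M) ('X - z%:P).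
Proof.
rewrite (perm_big _ (permEl (perm_sort _ _))) /=.
case: closed_field_poly_normal => s /= {1}->.
by rewrite (monicP (char_poly_monic _)) scale1r.
Qed.

Lemma size_eigenvalues M : size (eigenvalues M) = d.
Proof.
apply: succn_inj; rewrite -(size_char_poly (map_mx (real_complex R) M)).
by rewrite -/(complex_char_poly M) eigenvaluesE size_prod_XsubC.
Qed.

Lemma sorted_eigenvalues M :
  sorted (fun x y => modulus y <= modulus x) (eigenvalues M).
Proof. by apply: sort_sorted => x y; exact: le_total. Qed.

Lemma size_singular_values M : size (singular_values M) = d.
Proof. by rewrite size_sort size_map size_eigenvalues. Qed.

(* Sequences start at 0, so X k stands for the factor of index k + 1, and
   mx_product X n is the product of the first n factors, newest on the left. *)
Fixpoint mx_product (X : nat -> 'M[R]_d) (n : nat) : 'M[R]_d :=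
  if n is k.+1 then X k *m mx_product X k else 1%:M.

End spectrum.

(* Main.v *)
Require Import Defs.
From HB Require Import structures.
From mathcomp Require Import all_boot all_order all_algebra.
From mathcomp Require Import fingroup perm finmap.
From mathcomp Require Import all_classical all_reals all_analysis.
From mathcomp Require Import measurable_realfun.
From mathcomp Require Import ring lra.
Import Order.TTheory GRing.Theory Num.Theory.
Import numFieldNormedType.Exports.
Local Open Scope classical_set_scope.
Local Open Scope ring_scope.

(** Eigenvalues and singular values are both compared, with explicit
    probabilities, with the minors of the product.

    Write M for the product of the first n + 1 matrices, and for p <= d let
    L p and S p be the products of the p largest moduli of eigenvalues and of
    the p largest singular values.  Since the p-th ratio is a quotient of
    L p.+1 / S p.+1 by L p / S p, it is enough to show that each L p and S p
    agree up to a factor polynomial in n: its logarithm is O (ln n), which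
    every n^r dominates.  Both are compared with the p x p minors of M.

    - The sum of all squared p x p minors is, by Cauchy-Binet, the p-th
      elementary symmetric function of the squared singular values, so S p is
      the size of the largest minor up to a constant depending on d only.
    - L p is at most a constant times the largest minor
      ([eigen_prod_le_minors]): in a triangular form of M with the eigenvalues
      in decreasing order, the first p basis rows span an invariant subspace,
      and its Pluecker coordinates form an eigenvector, of eigenvalue the
      product of the first p eigenvalues, of the matrix of all minors.
    - Conversely L p is at least a constant times the absolute value of the
      sum of the principal minors, which is the p-th elementary symmetric
      function of the eigenvalues ([minor_sum_le_eigen]).

    So all that has to be excluded is cancellation in the sum of the principal
    minors ([log_eigen_singular_ratio]).  Write M = X B with X the newest
    factor and B the product of the older ones.  As a function of the entries
    of X this sum is a polynomial of degree at most one in each entry,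
    homogeneous of degree p, whose coefficients are p! times minors of B
    ([minor_sum_multi_affine]).  The bound on
    E|xi - a|^(- tau), uniform in a, says that an entry falls into any interval
    of length e with probability O (e^tau), even when the interval depends on
    everything independent of that entry ([small_ball_independent]).  Removing
    the p variables of a monomial one at a time, the polynomial is at least
    e^p times any of its coefficients outside an event of probability
    O (e^tau) ([multi_affine_small_ball]).  The bound on E|xi|^tau gives
    |X i j| <= 1/e outside an event of the same order, so that the minors of M
    exceed those of B at most by a factor of order e^(- p).

    With e = (n + 1)^(- 2 / tau) these probabilities are O (1 / (n + 1)^2), and
    Borel-Cantelli concludes.  If a singular value vanishes, the quotient and its
    logarithm are 0 by convention. *)

Set Implicit Arguments.
Unset Strict Implicit.
Unset Printing Implicit Defensive.

(** * Minors and the Cauchy-Binet formula *)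

(** Row and column selections are arbitrary functions rather than increasing
    ones: the redundant minors only contribute repetitions and zeros, and the
    sums below need no bookkeeping of index sets. *)
Definition minor (K : comNzRingType) (p m n : nat) (f : 'I_p -> 'I_m)
  (g : 'I_p -> 'I_n) (A : 'M[K]_(m, n)) : K := \det (mxsub f g A).

(** This is p! times the p-th elementary symmetric function of the eigenvalues,
    the coefficient of degree d - p of the characteristic polynomial up to
    sign; see [minor_sum_eigen]. *)
Definition minor_sum (K : comNzRingType) (d p : nat) (A : 'M[K]_d) : K :=
  \sum_(f : {ffun 'I_p -> 'I_d}) minor f f A.

Section Minors.
Variable K : comNzRingType.

Lemma minor_not_inj (p m n : nat) (f : 'I_p -> 'I_m) (g : 'I_p -> 'I_n)
  (A : 'M[K]_(m, n)) : ~~ injectiveb f -> minor f g A = 0.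
Proof.
case/injectivePn => i [j ij fij].
by apply: (determinant_alternate ij) => k; rewrite !mxE fij.
Qed.

Lemma minor_tr (p m n : nat) (f : 'I_p -> 'I_m) (g : 'I_p -> 'I_n)
  (A : 'M[K]_(m, n)) : minor g f A^T = minor f g A.
Proof. by rewrite /minor -trmx_mxsub det_tr. Qed.

Lemma minor_rperm (p m n : nat) (f : 'I_p -> 'I_m) (g : 'I_p -> 'I_n)
  (A : 'M[K]_(m, n)) (s : 'S_p) :
  minor (f \o s) g A = (-1) ^+ s * minor f g A.
Proof.
rewrite /minor -det_perm -det_mulmx -row_permE; congr (\det _).
by apply/matrixP => i j; rewrite !mxE.
Qed.

Lemma minor_perm2 (p m n : nat) (f : 'I_p -> 'I_m) (g : 'I_p -> 'I_n)
  (A : 'M[K]_(m, n)) (s : 'S_p) :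
  minor (f \o s) (g \o s) A = minor f g A.
Proof.
by rewrite minor_rperm -minor_tr minor_rperm mulrA -expr2 sqrr_sign mul1r
  minor_tr.
Qed.

(** Multilinearity in the rows alone; it is the form in which the entries of
    [A] appear as monomials. *)
Lemma minor_mul_rows (p m n k : nat) (f : 'I_p -> 'I_m) (g : 'I_p -> 'I_n)
  (A : 'M[K]_(m, k)) (B : 'M[K]_(k, n)) :
  minor f g (A *m B) =
  \sum_(h : {ffun 'I_p -> 'I_k}) (\prod_i A (f i) (h i)) * minor h g B.
Proof.
transitivity (\sum_(s : 'S_p) \sum_(h : {ffun 'I_p -> 'I_k})
    (-1) ^+ s * \prod_i (A (f i) (h i) * B (h i) (g (s i)))).
  apply: eq_bigr => s _; rewrite -big_distrr /=; congr (_ * _).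
  rewrite -(bigA_distr_bigA (fun i j => A (f i) j * B j (g (s i)))) /=.
  by apply: eq_bigr => i _; rewrite !mxE.
rewrite exchange_big; apply: eq_bigr => /= h _.
rewrite [RHS]big_distrr /=; apply: eq_bigr => s _.
rewrite big_split /= mulrCA; do 2!congr (_ * _).
by apply: eq_bigr => i _; rewrite !mxE.
Qed.

Lemma sum_ffun_perm (V : nmodType) (p n : nat) (s : 'S_p)
    (F : {ffun 'I_p -> 'I_n} -> V) :
  \sum_h F h = \sum_(h : {ffun 'I_p -> 'I_n}) F [ffun i => h (s i)].
Proof.
rewrite (reindex (fun h : {ffun 'I_p -> 'I_n} => [ffun i => h (s i)])) //.
exists (fun h : {ffun 'I_p -> 'I_n} => [ffun i => h ((s^-1)%g i)]) => h _;
  by apply/ffunP => i; rewrite !ffunE ?permK ?permKV.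
Qed.

(** Antisymmetrizing the rowwise expansion over the permutations of the p rows
    turns its monomials in [A] into minors; the sum over all functions h instead
    of p-subsets produces the factor p!. *)
Lemma cauchy_binet (p m n k : nat) (f : 'I_p -> 'I_m) (g : 'I_p -> 'I_n)
  (A : 'M[K]_(m, k)) (B : 'M[K]_(k, n)) :
  p`!%:R * minor f g (A *m B) =
  \sum_(h : {ffun 'I_p -> 'I_k}) minor f h A * minor h g B.
Proof.
have -> : p`!%:R * minor f g (A *m B) = \sum_(s : 'S_p) minor f g (A *m B).
  by rewrite sumr_const card_Sn mulr_natl.
(* Reindexing the rowwise expansion by h \o s antisymmetrizes it. *)
have E (s : 'S_p) : minor f g (A *m B) = \sum_(h : {ffun 'I_p -> 'I_k})
    ((-1) ^+ s * \prod_i A (f i) (h (s i))) * minor h g B.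
  rewrite minor_mul_rows (sum_ffun_perm s); apply: eq_bigr => h _.
  rewrite [RHS]mulrAC [RHS]mulrC; congr (_ * _).
    by apply: eq_bigr => i _; rewrite ffunE.
  rewrite -minor_rperm /minor; congr (\det _).
  by apply/matrixP => i j; rewrite !mxE ffunE.
under [LHS]eq_bigr => s _ do rewrite (E s).
rewrite exchange_big; apply: eq_bigr => h _ /=.
rewrite -big_distrl; congr (_ * _); apply: eq_bigr => s _; congr (_ * _).
by apply: eq_bigr => i _; rewrite !mxE.
Qed.

(** Makes [minor_sum] invariant under conjugation. *)
Lemma minor_sumC (d p : nat) (A B : 'M[K]_d) :
  p`!%:R * minor_sum p (A *m B) = p`!%:R * minor_sum p (B *m A).
Proof.
rewrite /minor_sum !big_distrr /=.
under eq_bigr do rewrite cauchy_binet.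
under [RHS]eq_bigr do rewrite cauchy_binet.
rewrite exchange_big; apply: eq_bigr => g _; apply: eq_bigr => f _.
by rewrite mulrC.
Qed.

(** The bridge between singular values and minors. *)
Lemma minor_sum_tr_mul (d p : nat) (A : 'M[K]_d) :
  p`!%:R * minor_sum p (A^T *m A) =
  \sum_(f : {ffun 'I_p -> 'I_d}) \sum_(g : {ffun 'I_p -> 'I_d})
    minor g f A ^+ 2.
Proof.
rewrite /minor_sum big_distrr; apply: eq_bigr => f _ /=.
by rewrite cauchy_binet; apply: eq_bigr => g _; rewrite minor_tr expr2.
Qed.

Lemma minor_map (L : comNzRingType) (phi : {rmorphism K -> L}) (p m n : nat)
    (f : 'I_p -> 'I_m) (g : 'I_p -> 'I_n) (A : 'M[K]_(m, n)) :
  minor f g (map_mx phi A) = phi (minor f g A).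
Proof. by rewrite /minor -map_mxsub det_map_mx. Qed.

Lemma minor_sum_map (L : comNzRingType) (phi : {rmorphism K -> L}) (d p : nat)
    (A : 'M[K]_d) : minor_sum p (map_mx phi A) = phi (minor_sum p A).
Proof.
by rewrite /minor_sum rmorph_sum; apply: eq_bigr => f _; rewrite minor_map.
Qed.

Lemma minor_trig (d p : nat) (f : 'I_p -> 'I_d) (T : 'M[K]_d) :
  is_trig_mx T -> injective f -> minor f f T = \prod_i T (f i) (f i).
Proof.
move=> /is_trig_mxP trigT f_inj; rewrite /minor /determinant.
rewrite (bigD1 (1%g : 'S_p)) //= [X in _ + X]big1 ?addr0 => [|s s1].
  rewrite odd_perm1 mul1r; apply: eq_bigr => i _.
  by rewrite !mxE perm1.
(* A permutation other than 1 moves some entry above the diagonal: otherwise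
   f (s i) <= f i for all i, and the equal sums force equality throughout. *)
suff [i lt_i] : exists i, (f i < f (s i))%N.
  by rewrite (bigD1 i) //= !mxE trigT // mul0r mulr0.
apply/existsP; apply: contraNT s1 => /existsPn le_s.
have le_f i : (f (s i) <= f i)%N by rewrite leqNgt le_s.
have leif_f i : true -> (f (s i) <= f i ?= iff (f (s i) == f i :> nat))%N.
  by move=> _; split; [exact: le_f|].
have [_] := leqif_sum leif_f.
have <- : (\sum_i f i = \sum_i f (s i))%N by rewrite (reindex_perm s).
rewrite eqxx => /esym/forallP eq_f.
apply/eqP/permP => i; rewrite perm1; apply: f_inj; apply: val_inj.
by apply/eqP; apply: eq_f.
Qed.

End Minors.

(** * The sum of principal minors of a product as a multi-affine polynomial *)

Definition positions (d p : nat) (f g : {ffun 'I_p -> 'I_d}) :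
    {set 'I_d * 'I_d} := [set (f i, g i) | i in 'I_p].

(** The coefficient of the monomial with set of variables [S] in the expansion
    of [minor_sum p (A *m B)]. *)
Definition minor_coef (K : comNzRingType) (d p : nat) (B : 'M[K]_d)
    (S : {set 'I_d * 'I_d}) : K :=
  \sum_(fg : {ffun 'I_p -> 'I_d} * {ffun 'I_p -> 'I_d}
        | positions fg.1 fg.2 == S) minor fg.2 fg.1 B.

Section MinorCoef.
Variables (d p : nat).
Implicit Types f g : {ffun 'I_p -> 'I_d}.

Lemma card_positions_le f g : (#|positions f g| <= p)%N.
Proof. by rewrite (leq_trans (leq_imset_card _ _)) // card_ord. Qed.

Lemma card_positions f g : injective f -> #|positions f g| = p.
Proof. by move=> f_inj; rewrite card_imset ?card_ord // => i j [/f_inj]. Qed.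

(** When f is injective the positions (f i, g i) are distinct, so no entry of
    [A] occurs twice in a monomial; the other f contribute vanishing minors. *)
Lemma minor_sum_multi_affine (K : comNzRingType) (A B : 'M[K]_d) :
  minor_sum p (A *m B) =
  \sum_(S : {set 'I_d * 'I_d}) minor_coef p B S * \prod_(u in S) A u.1 u.2.
Proof.
rewrite /minor_sum; under eq_bigr do rewrite minor_mul_rows.
rewrite pair_big (partition_big (fun fg => positions fg.1 fg.2) xpredT) //=.
apply: eq_bigr => S _; rewrite /minor_coef big_distrl /=.
apply: eq_bigr => -[f g] /= /eqP <-; rewrite mulrC.
have [/injectiveP f_inj|f_ninj] := boolP (injectiveb f); last first.
  by rewrite -minor_tr minor_not_inj // !mul0r.
by rewrite big_imset //= => i j _ _ [/f_inj].
Qed.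

(** Homogeneity of degree p: a monomial has at most p variables. *)
Lemma minor_coef_proper (K : comNzRingType) (B : 'M[K]_d) f g
    (S : {set 'I_d * 'I_d}) :
  injective f -> positions f g \proper S -> minor_coef p B S = 0.
Proof.
move=> f_inj /proper_card; rewrite card_positions // => lt_pS.
rewrite /minor_coef big_pred0 // => -[f' g'] /=; apply/eqP => eqS.
by have := card_positions_le f' g'; rewrite eqS leqNgt lt_pS.
Qed.

(** No cancellation inside a coefficient: two pairs with the same set of
    positions differ by a simultaneous permutation, which preserves the minor. *)
Lemma minor_le_coef (K : numDomainType) (B : 'M[K]_d) f g :
  injective f -> `|minor g f B| <= `|minor_coef p B (positions f g)|.
Proof.
move=> f_inj; rewrite /minor_coef (eq_bigr (fun _ => minor g f B)); last first.
  move=> -[f' g'] /= /eqP eq_pos.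
  have /fin_all_exists[s sE] i : exists j, (f' i, g' i) = (f j, g j).
    have : (f' i, g' i) \in positions f g by rewrite -eq_pos imset_f.
    by case/imsetP => j _ ->; exists j.
  have s_inj : injective s.
    have pos_s : positions f' g' = [set (f j, g j) | j in s @: [set: 'I_p]%SET]%SET.
      rewrite -imset_comp; apply/finset.setP => u; apply/imsetP/imsetP => -[i _ ->].
        by exists i; [rewrite inE | exact: sE].
      by exists i => //=; exact/esym/sE.
    have /imset_injP s_inj : #|s @: [set: 'I_p]%SET| == #|[set: 'I_p]%SET|.
      rewrite cardsT card_ord -[X in _ == X](card_positions g f_inj) -eq_pos pos_s.
      by rewrite eq_sym card_imset // => i j [/f_inj].
    by move=> i j; apply: s_inj; rewrite inE.
  rewrite -(minor_perm2 g f B (perm s_inj)) /minor; congr (\det _).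
  by apply/matrixP => i j; rewrite !mxE /= !permE; case: (sE i) (sE j) => _ -> [-> _].
rewrite sumr_const normrMn -[leLHS]mulr1n ler_wpMn2l //.
by apply/card_gt0P; exists (f, g); exact: eqxx.
Qed.

Lemma minor_mul_le (K : numDomainType) (A B : 'M[K]_d) (a b : K) f g :
  (forall i j, `|A i j| <= a) ->
  (forall h : {ffun 'I_p -> 'I_d}, `|minor h g B| <= b) ->
  `|minor f g (A *m B)| <= (d ^ p)%:R * a ^+ p * b.
Proof.
move=> le_a le_b; rewrite minor_mul_rows; apply: le_trans (ler_norm_sum _ _ _) _.
apply: (@le_trans _ _ (\sum_(h : {ffun 'I_p -> 'I_d}) a ^+ p * b)).
  apply: ler_sum => h _; rewrite normrM ler_pM // normr_prod.
  have -> : a ^+ p = \prod_(i < p) a by rewrite prodr_const card_ord.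
  by apply: ler_prod => i _; rewrite normr_ge0 le_a.
by rewrite sumr_const card_ffun !card_ord -mulrA mulr_natl.
Qed.

End MinorCoef.

(** * Triangularization with a prescribed order of the eigenvalues *)

Section Triangular.
Variable K : fieldType.

(** Conjugation is stated without an inverse to fit the recursion below. *)
Lemma char_poly_conj (d : nat) (P M N : 'M[K]_d) :
  P \in unitmx -> P *m M = N *m P -> char_poly M = char_poly N.
Proof.
move=> uP PM; have detP : \det (map_mx polyC P) != 0.
  by rewrite det_map_mx polyC_eq0 -unitfE -unitmxE.
apply: (mulfI detP); rewrite [RHS]mulrC -!det_mulmx; congr (\det _).
rewrite /char_poly_mx mulmxBr mulmxBl -!map_mxM PM.
by rewrite scalar_mxC.
Qed.

Lemma char_poly_lblock (a : K) (d : nat) (b : 'cV[K]_d) (N : 'M[K]_d) :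
  char_poly (block_mx a%:M 0 b N : 'M[K]_(1 + d)) =
  ('X - a%:P) * char_poly N.
Proof.
rewrite /char_poly /char_poly_mx map_block_mx /= scalar_mx_block.
rewrite opp_block_mx add_block_mx map_mx0 subr0 det_lblock; congr (_ * _).
by rewrite det_mx11 !mxE eqxx.
Qed.

(** The order of the diagonal is prescribed: any eigenvalue may be split off
    first, by completing one of its eigenvectors to a basis, and the others
    remain the eigenvalues of the complementary block. *)
Lemma triangularization (d : nat) (M : 'M[K]_d) (z : seq K) :
  char_poly M = \prod_(x <- z) ('X - x%:P) ->
  exists P T : 'M[K]_d, [/\ P \in unitmx, P *m M = T *m P, is_trig_mx T
    & forall i, T i i = z`_i].
Proof.
elim: d M z => [|d IHd] M z charM.
  exists 1%:M, M; split; [exact: unitmx1 | by rewrite mul1mx mulmx1 | |by case].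
  by apply/is_trig_mxP => -[].
rewrite -[d.+1]/(1 + d)%N in M charM *.
have sz_z : size z = d.+1.
  by apply: succn_inj; rewrite -(size_char_poly M) charM size_prod_XsubC.
case: z sz_z charM => // a z _; rewrite big_cons => charM.
have /eigenvalueP[v vM v0] : eigenvalue M a.
  by rewrite eigenvalue_root_char charM rootM root_XsubC eqxx.
(* An invertible matrix whose first row is proportional to v. *)
pose Q : 'M[K]_(1 + d) := row_ebase v.
have [c c0 vE] : exists2 c, c != 0 & v = c *: row 0 Q.
  have rv : \rank v = 1%N by rewrite rank_rV v0.
  exists (col_ebase v 0 0).
    have := col_ebase_unit v; rewrite unitmxE [col_ebase v]mx11_scalar det_scalar1.
    by rewrite mxE unitfE.
  rewrite -{1}(mulmx_ebase v) rv [col_ebase v]mx11_scalar -mulmxA mul_scalar_mx.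
  congr (_ *: _); rewrite ?mxE //; apply/rowP => j; rewrite !mxE (bigD1 0) //=.
  rewrite !mxE eqxx mul1r big1 ?addr0 // => k k0.
  by move: k0; rewrite !mxE -val_eqE /= eq_sym => /negPf ->; rewrite mul0r.
have uQ : Q \in unitmx by exact: row_ebase_unit.
pose N : 'M[K]_(1 + d) := Q *m M *m invmx Q.
have QM : Q *m M = N *m Q by rewrite /N mulmxKV.
have row0N : row 0 N = a *: row 0 1%:M.
  apply: (scalerI c0); rewrite /N !row_mul !scalemxAl -vE vM vE.
  by rewrite -!scalemxAl -row_mul mulmxV // !scalerA mulrC.
clearbody N.
have N0 j : N 0 j = a * (0 == j)%:R.
  by have /rowP/(_ j) := row0N; rewrite !mxE.
have NE : N = block_mx a%:M 0 (dlsubmx N) (drsubmx N).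
  rewrite -[LHS]submxK; congr block_mx; apply/matrixP => i j;
    rewrite !ord1 !mxE (_ : lshift d 0 = 0) ?N0 ?mulr1 ?mulr0 //.
    exact: val_inj.
  exact: val_inj.
have charN : char_poly (drsubmx N) = \prod_(x <- z) ('X - x%:P).
  apply: (@mulfI _ ('X - a%:P)); first by rewrite polyXsubC_eq0.
  rewrite -charM (char_poly_conj uQ QM) NE.
  by rewrite char_poly_lblock block_mxKdr.
have [P' [T' [uP' PM' trigT' diagT']]] := IHd _ _ charN.
pose D : 'M[K]_(1 + d) := block_mx 1%:M 0 0 P'.
pose T : 'M[K]_(1 + d) := block_mx a%:M 0 (P' *m dlsubmx N) T'.
exists (D *m Q), T; split.
- by rewrite unitmx_mul uQ andbT unitmxE det_lblock det1 mul1r -unitmxE uP'.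
- rewrite -mulmxA QM !mulmxA; congr (_ *m _).
  rewrite {1}NE /D /T !mulmx_block !(mul0mx, mulmx0, mul1mx, mulmx1, addr0, add0r).
  by rewrite PM'.
- by rewrite is_trig_block_mx // eqxx trigT' andbT mx11_is_trig.
- move=> i; rewrite /T; case: (split_ordP i) => j ->.
    by rewrite block_mxEul !ord1 mxE eqxx.
  by rewrite block_mxEdr diagT'.
Qed.
End Triangular.

(** * Products of eigenvalues against minors *)

Lemma inj_exists_ge (p : nat) (f : 'I_p.+1 -> nat) :
  injective f -> exists i, (p <= f i)%N.
Proof.
move=> f_inj; apply/existsP; apply: contraT => /existsPn f_lt.
have lt_f i : (f i < p)%N by rewrite ltnNge f_lt.
have g_inj : injective (fun i => Ordinal (lt_f i)).
  by move=> i j /(congr1 val) /f_inj.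
by have := leq_card _ g_inj; rewrite !card_ord ltnn.
Qed.

(** Some index has a value of f at least equal to the number of the other
    indices; pair it with the last factor and induct. *)
Lemma prod_inj_le (K : numDomainType) (a : nat -> K) (p : nat)
    (f : 'I_p -> nat) :
  (forall i, 0 <= a i) -> (forall i j, (i <= j)%N -> a j <= a i) ->
  injective f -> \prod_i a (f i) <= \prod_(i < p) a i.
Proof.
move=> a_ge0 a_dec; elim: p f => [|p IHp] f f_inj; first by rewrite !big_ord0.
have [j le_pfj] := inj_exists_ge f_inj.
rewrite (bigD1_ord j) //= big_ord_recr /= mulrC ler_pM ?prodr_ge0 //.
  by apply: IHp; exact: inj_comp f_inj lift_inj.
exact: a_dec.
Qed.

Section Spectrum.
Variables (K : numFieldType) (d : nat) (M : 'M[K]_d) (z : seq K).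
Hypothesis charM : char_poly M = \prod_(x <- z) ('X - x%:P).

Lemma fact_neq0 (p : nat) : p`!%:R != 0 :> K.
Proof. by rewrite pnatr_eq0 -lt0n fact_gt0. Qed.

(** Both sides are invariant under conjugation, and for a triangular matrix a
    principal minor is the product of the diagonal entries it selects. *)
Lemma minor_sum_eigen (p : nat) :
  minor_sum p M =
  \sum_(f : {ffun 'I_p -> 'I_d} | injectiveb f) \prod_i z`_(f i).
Proof.
have [P [T [uP PM trigT diagT]]] := triangularization charM.
transitivity (minor_sum p T).
  apply: (mulfI (fact_neq0 p)); have -> : M = invmx P *m (T *m P).
    by rewrite -PM mulKmx.
  by rewrite minor_sumC -mulmxA mulmxV // mulmx1.
rewrite /minor_sum (bigID (fun f : {ffun 'I_p -> 'I_d} => injectiveb f)) /= [X in _ + X]big1 ?addr0.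
  apply: eq_bigr => f /injectiveP f_inj; rewrite minor_trig //.
  by apply: eq_bigr => i _; rewrite diagT.
by move=> f; exact: minor_not_inj.
Qed.

(** A form of the inequality of Weyl with a constant.  The maximal minors v h of
    the first p rows of the triangularizing matrix form a nonzero row vector
    that the matrix of minors multiplies by the product of the first p
    eigenvalues; hence that product is at most the largest row sum. *)
Lemma eigen_prod_le_minors (p : nat) (mu : K) : (p <= d)%N ->
  (forall f g : {ffun 'I_p -> 'I_d}, `|minor f g M| <= mu) ->
  p`!%:R * `|\prod_(i < p) z`_i| <= (d ^ p)%:R * mu.
Proof.
move=> le_pd le_mu; have [P [T [uP PM trigT diagT]]] := triangularization charM.
pose w := widen_ord le_pd; pose v (h : {ffun 'I_p -> 'I_d}) := minor w h P.
pose s := \sum_h `|v h|.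
have w_inj : injective w by move=> i j /(congr1 val) /= ij; apply: val_inj.
have s_gt0 : 0 < s.
  rewrite lt0r sumr_ge0 ?andbT //; apply/eqP => s0.
  have v0 h : v h = 0.
    by apply/eqP; rewrite -normr_eq0; apply/eqP; apply: (psumr_eq0P _ s0).
  have := cauchy_binet w w P (invmx P); rewrite mulmxV // big1 => [/eqP|h _].
    rewrite mulf_eq0 (negPf (fact_neq0 p)) /minor /=.
    rewrite (_ : mxsub w w 1%:M = 1%:M) ?det1 ?oner_eq0 //.
    by apply/matrixP => i j; rewrite !mxE (inj_eq w_inj).
  by rewrite -/(v h) v0 mul0r.
have detA : minor w w T = \prod_(i < p) z`_i.
  by rewrite minor_trig //; apply: eq_bigr => i _; rewrite diagT.
(* The first p rows V of P satisfy V M = A V with A the leading block of T. *)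
have vM h : p`!%:R * (\prod_(i < p) z`_i * v h) =
    \sum_(g : {ffun 'I_p -> 'I_d}) v g * minor g h M.
  rewrite -cauchy_binet -detA -det_mulmx; congr (_ * \det _); rewrite PM.
  apply/matrixP => i j; rewrite !mxE [RHS](bigID (fun k : 'I_d => (k < p)%N)) /=.
  rewrite [X in _ = _ + X]big1 ?addr0 => [|k].
    rewrite (big_ord_narrow le_pd); apply: eq_bigr => k _.
    by rewrite !mxE.
  rewrite -leqNgt => le_pk; move/is_trig_mxP: trigT => ->; rewrite ?mul0r //=.
  exact: leq_trans (ltn_ord i) le_pk.
have le_v h : p`!%:R * `|\prod_(i < p) z`_i| * `|v h| <= s * mu.
  rewrite -[p`!%:R]normr_nat -!normrM -mulrA vM.
  apply: le_trans (ler_norm_sum _ _ _) _; rewrite /s big_distrl /=.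
  by apply: ler_sum => g _; rewrite normrM ler_wpM2l.
(* The sum of the |v h| stands in for their maximum, the field being only
   partially ordered. *)
rewrite -(ler_pM2r s_gt0) {1}/s big_distrr /= [leRHS]mulrAC -[leRHS]mulrA.
apply: (le_trans (ler_sum _ (fun h _ => le_v h))).
by rewrite sumr_const card_ffun !card_ord mulr_natl.
Qed.

Hypothesis z_sorted : forall i j, (i <= j)%N -> `|z`_j| <= `|z`_i|.

Lemma minor_sum_le_eigen (p : nat) :
  `|minor_sum p M| <= (d ^ p)%:R * `|\prod_(i < p) z`_i|.
Proof.
rewrite minor_sum_eigen; apply: le_trans (ler_norm_sum _ _ _) _.
apply: (@le_trans _ _ (\sum_(f : {ffun 'I_p -> 'I_d}) `|\prod_(i < p) z`_i|)).
  rewrite [leRHS](bigID (fun f : {ffun 'I_p -> 'I_d} => injectiveb f)) /= ler_wpDr ?sumr_ge0 //.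
  apply: ler_sum => f /injectiveP f_inj; rewrite !normr_prod.
  apply: (prod_inj_le (a := fun i => `|z`_i|) (f := fun i => f i : nat)) => //.
  by move=> i j /val_inj /f_inj.
by rewrite sumr_const card_ffun !card_ord mulr_natl.
Qed.

Lemma eigen_prod_le_minor_sum (p : nat) : (p <= d)%N ->
  (forall i, 0 <= z`_i) -> \prod_(i < p) z`_i <= minor_sum p M.
Proof.
move=> le_pd z_ge0; rewrite minor_sum_eigen.
pose w : {ffun 'I_p -> 'I_d} := [ffun i => widen_ord le_pd i].
have w_inj : injectiveb w.
  by apply/injectiveP => i j; rewrite !ffunE => /(congr1 val) /= /val_inj.
rewrite (bigD1 w) //= (eq_bigr (fun i : 'I_p => z`_(w i))) => [|i _].
  by rewrite lerDl sumr_ge0 // => f _; rewrite prodr_ge0.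
by rewrite ffunE.
Qed.

End Spectrum.

(** * Singular values and the deterministic estimate *)

Section Spectral.
Variables (R : realType) (d : nat).
Implicit Types M : 'M[R]_d.

Lemma char_poly_eigenvalues M :
  char_poly (map_mx (real_complex R) M) =
  \prod_(x <- eigenvalues M) ('X - x%:P).
Proof. exact: eigenvaluesE. Qed.

Lemma modulus_ge0 (z : R[i]) : 0 <= modulus z.
Proof. by rewrite -lecR -modulusE; exact: normr_ge0. Qed.

Lemma modulus_eigenvalues_anti M (i j : nat) : (i <= j)%N ->
  modulus (eigenvalues M)`_j <= modulus (eigenvalues M)`_i.
Proof.
move=> le_ij; have [lt_j|le_j] := ltnP j (size (eigenvalues M)); last first.
  by rewrite [X in modulus X <= _]nth_default // /modulus
    ComplexField.Normc.normc0 modulus_ge0.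
have tr : transitive (fun x y : R[i] => modulus y <= modulus x).
  by move=> y x z /[swap]; exact: le_trans.
have re : reflexive (fun x y : R[i] => modulus y <= modulus x) by move=> x.
apply: (sorted_leq_nth tr re 0 (sorted_eigenvalues M)) => //.
by rewrite inE (leq_ltn_trans le_ij).
Qed.

(** For an eigenvector v of the eigenvalue z, z times the squared norm of v is
    the squared norm of v *m A^T. *)
Lemma eigenvalues_gram_ge0 M (z : R[i]) : z \in eigenvalues (M^T *m M) -> 0 <= z.
Proof.
move=> z_eig; pose A := map_mx (real_complex R) M.
have /eigenvalueP[v vE v0] : eigenvalue (A^T *m A) z.
  rewrite eigenvalue_root_char /A map_trmx -map_mxM char_poly_eigenvalues.
  by rewrite root_prod_XsubC.
pose sq n (u : 'rV[R[i]]_n) := \sum_j `|u 0 j| ^+ 2.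
have sqE n (u : 'rV_n) : (u *m (map_mx Num.conj u)^T) 0 0 = sq n u.
  by rewrite mxE; apply: eq_bigr => j _; rewrite !mxE normCK.
have sq_gt0 : 0 < sq _ v.
  rewrite lt0r sumr_ge0 ?andbT => [|j _]; last by rewrite exprn_ge0.
  apply: contra_neq v0 => s0; apply/rowP => j; rewrite !mxE.
  apply/eqP; rewrite -normr_eq0 -sqrf_eq0; apply/eqP.
  by apply: (psumr_eq0P _ s0) => // k _; rewrite exprn_ge0.
have : sq _ (v *m A^T) = z * sq _ v.
  rewrite -sqE map_mxM trmx_mul mulmxA -(mulmxA v).
  have -> : (map_mx Num.conj A^T)^T = A.
    apply/matrixP => i j; rewrite !mxE; apply/CrealP/complex_realP; by exists (M i j).
 by rewrite vE -scalemxAl mxE sqE.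
move=> /(congr1 (fun t => t / sq _ v)); rewrite mulfK ?gt_eqF // => <-.
by rewrite divr_ge0 ?(ltW sq_gt0) // /sq sumr_ge0 // => j _; rewrite exprn_ge0.
Qed.

Lemma eigenvalues_gram_nth_ge0 M (i : nat) : 0 <= (eigenvalues (M^T *m M))`_i.
Proof.
have [lt_i|le_i] := ltnP i (size (eigenvalues (M^T *m M))).
  exact/eigenvalues_gram_ge0/mem_nth.
by rewrite nth_default.
Qed.

Lemma singular_values_nth M (i : nat) :
  (singular_values M)`_i = Num.sqrt (complex.Re (eigenvalues (M^T *m M))`_i).
Proof.
have eq_mod z : z \in eigenvalues (M^T *m M) -> modulus z = complex.Re z.
  move=> /eigenvalues_gram_ge0 z_ge0; apply: complexI.
  by rewrite -modulusE ger0_norm // RRe_real // ger0_real.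
rewrite /singular_values sorted_sort; last 2 first.
- by move=> y x z /[swap]; exact: le_trans.
- rewrite sorted_map; have /= := sorted_eigenvalues (M^T *m M).
  apply: sub_in_sorted (allss _) => x y xs ys /=.
  by rewrite !eq_mod // => ?; rewrite ler_wsqrtr.
have [lt_i|le_i] := ltnP i (size (eigenvalues (M^T *m M))).
  by rewrite (nth_map 0).
by rewrite !nth_default ?size_map //= sqrtr0.
Qed.

Lemma singular_value_ge0 M (i : nat) : 0 <= (singular_values M)`_i.
Proof. by rewrite singular_values_nth sqrtr_ge0. Qed.

Lemma singular_value_sqr M (i : nat) :
  ((singular_values M)`_i ^+ 2)%:C%C = (eigenvalues (M^T *m M))`_i.
Proof.
have z_ge0 := eigenvalues_gram_nth_ge0 M i.
rewrite singular_values_nth sqr_sqrtr ?RRe_real ?ger0_real //.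
by move: z_ge0; rewrite lecE /= => /andP[].
Qed.

Lemma singular_values_anti M (i j : nat) : (i <= j)%N ->
  (singular_values M)`_j <= (singular_values M)`_i.
Proof.
move=> le_ij; rewrite -(ler_pXn2r (n := 2)) ?nnegrE ?singular_value_ge0 //.
rewrite -lecR !singular_value_sqr -[leLHS]ger0_norm ?eigenvalues_gram_nth_ge0 //.
rewrite -[leRHS]ger0_norm ?eigenvalues_gram_nth_ge0 // !modulusE lecR.
exact: modulus_eigenvalues_anti.
Qed.

Definition eigen_prod M (p : nat) : R :=
  \prod_(i < p) modulus (eigenvalues M)`_i.

Definition singular_prod M (p : nat) : R :=
  \prod_(i < p) (singular_values M)`_i.

Lemma norm_eigen_prod M (p : nat) :
  `|\prod_(i < p) (eigenvalues M)`_i| = (eigen_prod M p)%:C%C.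
Proof.
rewrite normr_prod /eigen_prod rmorph_prod.
by apply: eq_bigr => i _; rewrite modulusE.
Qed.

Lemma singular_prod_sqr M (p : nat) :
  \prod_(i < p) (eigenvalues (M^T *m M))`_i = ((singular_prod M p) ^+ 2)%:C%C.
Proof.
rewrite /singular_prod -prodrXl rmorph_prod.
by apply: eq_bigr => i _; rewrite /= singular_value_sqr.
Qed.

Lemma modulus_real (x : R) : modulus x%:C%C = `|x|.
Proof. by apply: complexI; rewrite -modulusE normc_def /= expr0n addr0 sqrtr_sqr. Qed.

Lemma eigenvalues_norm_anti M (i j : nat) : (i <= j)%N ->
  `|(eigenvalues M)`_j| <= `|(eigenvalues M)`_i|.
Proof. by move=> ?; rewrite !modulusE lecR modulus_eigenvalues_anti. Qed.

Lemma minor_sum_le_eigen_prod M (p : nat) :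
  `|minor_sum p M| <= (d ^ p)%:R * eigen_prod M p.
Proof.
have := minor_sum_le_eigen (char_poly_eigenvalues M) (@eigenvalues_norm_anti M) p.
rewrite norm_eigen_prod minor_sum_map modulusE modulus_real.
by rewrite -[(d ^ p)%:R](rmorph_nat (real_complex R)) -rmorphM lecR.
Qed.

Lemma eigen_prod_le_minor M (p : nat) (mu : R) : (p <= d)%N ->
  (forall f g : {ffun 'I_p -> 'I_d}, `|minor f g M| <= mu) ->
  p`!%:R * eigen_prod M p <= (d ^ p)%:R * mu.
Proof.
move=> le_pd le_mu.
have := eigen_prod_le_minors (char_poly_eigenvalues M) (mu := mu%:C%C) le_pd.
rewrite norm_eigen_prod -[p`!%:R](rmorph_nat (real_complex R)).
rewrite -[(d ^ p)%:R](rmorph_nat (real_complex R)) -!rmorphM lecR; apply.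
by move=> f g; rewrite minor_map modulusE modulus_real lecR.
Qed.

Lemma gram_minor_sum_le_singular M (p : nat) :
  minor_sum p (M^T *m M) <= (d ^ p)%:R * singular_prod M p ^+ 2.
Proof.
apply: le_trans (ler_norm _) _; have := minor_sum_le_eigen_prod (M^T *m M) p.
have -> // : eigen_prod (M^T *m M) p = singular_prod M p ^+ 2.
apply: complexI; rewrite -norm_eigen_prod singular_prod_sqr modulusE modulus_real.
by rewrite ger0_norm ?sqr_ge0.
Qed.

Lemma singular_le_gram_minor_sum M (p : nat) : (p <= d)%N ->
  singular_prod M p ^+ 2 <= minor_sum p (M^T *m M).
Proof.
move=> le_pd; have := eigen_prod_le_minor_sum (char_poly_eigenvalues (M^T *m M))
  le_pd (eigenvalues_gram_nth_ge0 M).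
by rewrite singular_prod_sqr minor_sum_map lecR.
Qed.

(** A squared minor is one term of the sum of all squared minors. *)
Lemma minor_le_singular_prod M (p : nat) (f g : {ffun 'I_p -> 'I_d}) :
  `|minor f g M| <= p`!%:R * (d ^ p)%:R * singular_prod M p.
Proof.
have S_ge0 : 0 <= singular_prod M p.
  by rewrite prodr_ge0 // => i _; exact: singular_value_ge0.
rewrite -(ler_pXn2r (n := 2)) ?nnegrE ?mulr_ge0 //.
apply: (@le_trans _ _ (p`!%:R * minor_sum p (M^T *m M))).
  rewrite minor_sum_tr_mul (bigD1 g) //= (bigD1 f) //= real_normK ?num_real //.
  rewrite -addrA lerDl addr_ge0 ?sumr_ge0 // => *; rewrite ?sqr_ge0 //.
  by rewrite sumr_ge0 // => *; rewrite sqr_ge0.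
apply: (@le_trans _ _ (p`!%:R * ((d ^ p)%:R * singular_prod M p ^+ 2))).
  by rewrite ler_wpM2l // gram_minor_sum_le_singular.
rewrite mulrA [leRHS]exprMn ler_wpM2r ?sqr_ge0 // -natrM -natrX ler_nat.
by rewrite expnS expn1; case: (_ * _)%N => // k; rewrite leq_pmulr.
Qed.

Lemma singular_prod_le_minor M (p : nat) (mu : R) : (p <= d)%N -> 0 <= mu ->
  (forall f g : {ffun 'I_p -> 'I_d}, `|minor f g M| <= mu) ->
  singular_prod M p <= (d ^ p)%:R * mu.
Proof.
move=> le_pd mu_ge0 le_mu.
have S_ge0 : 0 <= singular_prod M p.
  by rewrite prodr_ge0 // => i _; exact: singular_value_ge0.
rewrite -(ler_pXn2r (n := 2)) ?nnegrE ?mulr_ge0 //.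
apply: le_trans (singular_le_gram_minor_sum M le_pd) _.
apply: (@le_trans _ _ (p`!%:R * minor_sum p (M^T *m M))).
  rewrite ler_peMl ?ler1n ?fact_gt0 //.
  by apply: le_trans (singular_le_gram_minor_sum M le_pd); rewrite sqr_ge0.
rewrite minor_sum_tr_mul.
apply: (@le_trans _ _ (\sum_(f : {ffun 'I_p -> 'I_d})
    \sum_(g : {ffun 'I_p -> 'I_d}) mu ^+ 2)).
  apply: ler_sum => f _; apply: ler_sum => g _.
  by rewrite -real_normK ?num_real // lerXn2r ?nnegrE.
by rewrite !sumr_const !card_ffun !card_ord -mulrnA exprMn -natrX mulr_natl expnS expn1.
Qed.

(** The upper bound on the eigenvalue products always holds; the hypothesis, that
    the sum of principal minors does not cancel below the fraction [c] of the
    largest minor, supplies the lower bound. *)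
Lemma log_eigen_singular_ratio M (c : R) : 0 < c <= 1 ->
  (forall p (f g : {ffun 'I_p -> 'I_d}), (p <= d)%N ->
     c * `|minor f g M| <= `|minor_sum p M|) ->
  forall p, (p < d)%N ->
    `|ln (modulus (eigenvalues M)`_p / (singular_values M)`_p)| <=
    2 * ln ((d ^ (2 * d))%:R / c).
Proof.
move=> /andP[c0 c1] minor_le p lt_pd; set C := (_ / c).
have d0 : (0 < d)%N by case: (d) lt_pd.
have D1 : 1 <= (d ^ (2 * d))%:R :> R by rewrite ler1n expn_gt0 d0.
have C1 : 1 <= C by rewrite ler_pdivlMr // mul1r (le_trans c1).
have C0 : 0 < C by rewrite (lt_le_trans _ C1).
have lnC : 0 <= ln C by rewrite ln_ge0.
have S_ge0 q : 0 <= singular_prod M q.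
  by rewrite prodr_ge0 // => i _; exact: singular_value_ge0.
have L_ge0 q : 0 <= eigen_prod M q.
  by rewrite prodr_ge0 // => i _; exact: modulus_ge0.
have dq q : (q <= d)%N -> (d ^ q)%:R * (d ^ q)%:R <= (d ^ (2 * d))%:R :> R.
  by move=> le_qd; rewrite -natrM ler_nat -expnD leq_pexp2l // mul2n -addnn leq_add.
have LS q : (q <= d)%N -> eigen_prod M q <= C * singular_prod M q.
  move=> le_qd; have q0 : 0 < q`!%:R :> R by rewrite ltr0n fact_gt0.
  rewrite -(ler_pM2l q0).
  apply: le_trans (eigen_prod_le_minor le_qd (@minor_le_singular_prod M q)) _.
  rewrite [leLHS](_ : _ = q`!%:R * ((d ^ q)%:R * (d ^ q)%:R * singular_prod M q)).
    rewrite ler_wpM2l // ler_wpM2r // (le_trans (dq q le_qd)) //.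
    by rewrite ler_pdivlMr // ler_piMr.
  by ring.
have SL q : (q <= d)%N -> singular_prod M q <= C * eigen_prod M q.
  move=> le_qd.
  apply: le_trans (singular_prod_le_minor (mu := (d ^ q)%:R * eigen_prod M q / c) le_qd _ _) _.
  - by rewrite divr_ge0 ?mulr_ge0 // ltW.
  - move=> f g; rewrite ler_pdivlMr // mulrC.
    exact: le_trans (minor_le _ _ _ le_qd) (minor_sum_le_eigen_prod _ _).
  rewrite !mulrA /C [leRHS]mulrAC ler_wpM2r ?invr_ge0 ?(ltW c0) //.
  by rewrite ler_wpM2r // dq.
(* If the singular value is 0, so are the quotient and its logarithm. *)
have [s0|s_neq0] := eqVneq (singular_values M)`_p 0.
  by rewrite s0 invr0 mulr0 ln0 ?lexx // normr0 mulr_ge0.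
have s_gt0 i : (i <= p)%N -> 0 < (singular_values M)`_i.
  move=> /(singular_values_anti M); apply: lt_le_trans.
  by rewrite lt0r s_neq0 singular_value_ge0.
have S_gt0 q : (q <= p.+1)%N -> 0 < singular_prod M q.
  by move=> le_qp; apply: prodr_gt0 => i _; apply: s_gt0; rewrite -ltnS (leq_trans _ le_qp).
have L_gt0 q : (q <= p.+1)%N -> 0 < eigen_prod M q.
  move=> le_qp; rewrite -(pmulr_rgt0 _ C0); apply: lt_le_trans (SL q _).
    exact: S_gt0.
  exact: leq_trans le_qp lt_pd.
pose rho q := eigen_prod M q / singular_prod M q.
have rho_gt0 q : (q <= p.+1)%N -> 0 < rho q.
  by move=> ?; rewrite divr_gt0 ?L_gt0 ?S_gt0.
have ln_rho q : (q <= p.+1)%N -> `|ln (rho q)| <= ln C.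
  move=> le_q; have le_qd := leq_trans le_q lt_pd.
  rewrite ler_norml -lnV ?posrE // !ler_ln ?posrE ?invr_gt0 ?rho_gt0 //.
  by rewrite ler_pdivlMr ?S_gt0 // ler_pdivrMr ?S_gt0 // LS // andbT mulrC ler_pdivrMr // mulrC SL.
have -> : modulus (eigenvalues M)`_p / (singular_values M)`_p = rho p.+1 / rho p.
  rewrite /rho {1}/eigen_prod {1}/singular_prod !big_ord_recr /=.
  rewrite -/(eigen_prod M p) -/(singular_prod M p).
  by field; rewrite s_neq0 !gt_eqF ?L_gt0 ?S_gt0.
rewrite lnM ?lnV ?posrE ?invr_gt0 ?rho_gt0 // mulr2n mulrDl mul1r.
by rewrite (le_trans (ler_normB _ _)) // lerD // ln_rho.
Qed.
End Spectral.

(** Non-cancellation relative to the minors of the older factor [B] is enough,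
    as the new factor [A] has entries at most 1 / e and so multiplies the minors
    of order q at most by (d / e)^q. *)
Lemma log_ratio_step (R : realType) (d : nat) (A B : 'M[R]_d) (e : R) :
  0 < e <= 1 -> (forall i j, `|A i j| <= e^-1) ->
  (forall p (f g : {ffun 'I_p -> 'I_d}), (p <= d)%N ->
     e ^+ p * `|minor f g B| <= `|minor_sum p (A *m B)|) ->
  forall p, (p < d)%N ->
    `|ln (modulus (eigenvalues (A *m B))`_p / (singular_values (A *m B))`_p)| <=
    2 * (ln (d ^ (3 * d))%:R + (2 * d)%:R * ln e^-1).
Proof.
move=> /andP[e0 e1] le_A le_minor p lt_pd.
have d0 : (0 < d)%N by case: (d) lt_pd.
have dX k : 1 <= (d ^ k)%:R :> R by rewrite ler1n expn_gt0 d0.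
have dX0 k : 0 < (d ^ k)%:R :> R by rewrite (lt_le_trans _ (dX k)).
pose c := e ^+ (2 * d) / (d ^ d)%:R.
have c01 : 0 < c <= 1.
  rewrite divr_gt0 ?exprn_gt0 //= ler_pdivrMr // mul1r.
  by rewrite (le_trans _ (dX d)) // exprn_ile1 // ltW.
have c_minor q (f g : {ffun 'I_q -> 'I_d}) : (q <= d)%N ->
    c * `|minor f g (A *m B)| <= `|minor_sum q (A *m B)|.
  move=> le_qd; set s := `|minor_sum q _|.
  have le_B (h : {ffun 'I_q -> 'I_d}) : `|minor h g B| <= s / e ^+ q.
    by rewrite ler_pdivlMr ?exprn_gt0 // mulrC; exact: le_minor.
  have /(ler_wpM2l (ltW (andP c01).1))/le_trans := minor_mul_le f le_A le_B.
  apply; rewrite /c.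
  have -> : e ^+ (2 * d) / (d ^ d)%:R * ((d ^ q)%:R * e^-1 ^+ q * (s / e ^+ q)) =
      (e ^+ (2 * d) * (e ^+ (2 * q))^-1) * ((d ^ q)%:R / (d ^ d)%:R) * s.
    rewrite mul2n -addnn exprD exprVn [(2 * q)%N]mul2n -addnn [e ^+ (q + q)]exprD.
    by field; rewrite expf_neq0 ?gt_eqF.
  rewrite ler_piMl ?normr_ge0 // mulr_ile1 ?mulr_ge0 ?invr_ge0 ?exprn_ge0 ?(ltW e0) //.
    rewrite ler_pdivrMr ?exprn_gt0 // mul1r ler_wiXn2l ?(ltW e0) //.
    by rewrite leq_mul2l.
  by rewrite ler_pdivrMr // mul1r ler_nat leq_pexp2l.
apply: le_trans (log_eigen_singular_ratio c01 c_minor lt_pd) _.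
rewrite ler_wpM2l // le_eqVlt; apply/orP; left; apply/eqP.
have -> : (d ^ (2 * d))%:R / c = (d ^ (3 * d))%:R * e^-1 ^+ (2 * d).
  rewrite /c invfM invrK exprVn [(3 * d)%N](_ : _ = 2 * d + d)%N; last by ring.
  by rewrite expnD natrM; ring.
rewrite lnM ?posrE ?exprn_gt0 ?invr_gt0 // lnXn ?invr_gt0 //.
by rewrite mulr_natl.
Qed.

(** * Independence and small balls *)

Lemma measurable_set_ltr (d : measure_display) (T : measurableType d)
    (R : realType) (f g : T -> R) :
  measurable_fun setT f -> measurable_fun setT g ->
  measurable [set w | f w < g w].
Proof.
move=> mf mg; have := measurable_fun_ltr mf mg.
by move=> /(_ measurableT [set true]); rewrite setTI; apply.
Qed.

Lemma measurable_set_ler (d : measure_display) (T : measurableType d)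
    (R : realType) (f g : T -> R) :
  measurable_fun setT f -> measurable_fun setT g ->
  measurable [set w | f w <= g w].
Proof.
move=> mf mg; have := measurable_fun_ler mf mg.
by move=> /(_ measurableT [set true]); rewrite setTI; apply.
Qed.

Section Independence.
Context (d : measure_display) (T : measurableType d) (R : realType)
  (P : probability T R).

(** Both sides are finite measures in C that agree on a pi-system. *)
Lemma independent_generated (G : set (set T)) (E : set T) :
  measurable E -> G `<=` measurable -> setI_closed G -> G setT ->
  (forall C, G C -> P (E `&` C) = (P E * P C)%E) ->
  forall C, <<s G >> C -> P (E `&` C) = (P E * P C)%E.
Proof.
move=> mE mG GI GT indG C sGC.
have PE_ge0 : 0 <= fine (P E) by rewrite fine_ge0.
have PE_fin : P E = (fine (P E))%:E by rewrite fineK // fin_num_measure.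
pose m1 := mrestr P mE; pose m2 := mscale (NngNum PE_ge0) P.
have m12 A : G A -> m1 A = m2 A.
  move=> GA; rewrite /m1 /m2 /mrestr /mscale /= setIC indG // -PE_fin.
  by [].
have -> : P (E `&` C) = m1 C by rewrite setIC.
have -> : (P E * P C)%E = m2 C by rewrite /m2 /mscale /= {1}PE_fin.
apply: (g_sigma_algebra_measure_unique G mG (fun=> setT) (fun=> GT)) => //.
  by rewrite bigcup_const.
by move=> _ /=; rewrite /mrestr setTI ltey_eq fin_num_measure.
Qed.

(** Both sides expand into the same product over [j] and [J]. *)
Lemma independent_split (d' : measure_display) (T' : measurableType d')
    (I : choiceType) (Y : I -> T -> T') (J : {fset I}) (j : I) (A : set T')
    (B : I -> set T') :
  mutually_independent P Y -> j \notin J -> measurable A ->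
  (forall i, measurable (B i)) ->
  P ((Y j @^-1` A) `&` \bigcap_(i in [set` J]) (Y i @^-1` B i)) =
  (P (Y j @^-1` A) * P (\bigcap_(i in [set` J]) (Y i @^-1` B i)))%E.
Proof.
move=> indY jJ mA mB; pose B' i := if i == j then A else B i.
have neq_j i : i \in J -> (i == j) = false.
  by move=> iJ; apply: contraNF jJ => /eqP <-.
have -> : (Y j @^-1` A) `&` \bigcap_(i in [set` J]) (Y i @^-1` B i) =
    \bigcap_(i in [set` (j |` J)%fset]) (Y i @^-1` B' i).
  rewrite set_fsetU1 bigcap_setU1 /B' eqxx; congr (_ `&` _).
  by apply: eq_bigcapr => i /= iJ; rewrite neq_j.
rewrite !indY // => [|i]; last by rewrite /B'; case: ifP.
rewrite big_fsetU1 //= {1}/B' eqxx; congr (_ * _)%E.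
by rewrite !big_seq; apply: eq_bigr => i iJ; rewrite /B' neq_j.
Qed.

(** A deterministic small-ball bound transfers to a random centre Z independent
    of x.  On the event that Z lies in a given cell of length e, the centre can
    be replaced by the end of the cell at the price of doubling the radius; the
    probabilities of the cells add up to one. *)
Lemma small_ball_independent (x Z : T -> R) (e q : R) :
  0 < e -> measurable_fun setT x -> measurable_fun setT Z ->
  (forall A B, measurable A -> measurable B ->
    P ((x @^-1` A) `&` (Z @^-1` B)) = (P (x @^-1` A) * P (Z @^-1` B))%E) ->
  (forall a, (P [set w | `|x w - a| <= 2 * e]%R <= q%:E)%E) ->
  (P [set w | `|x w - Z w| <= e]%R <= q%:E)%E.
Proof.
move=> e0 mx mZ indxZ ball_le.
have q0 : 0 <= q by rewrite -lee_fin; apply: le_trans (ball_le 0); exact: measure_ge0.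
(* The number of the cell [m e, (m + 1) e) that contains y, and the left end of
   that cell. *)
pose idx (y : R) : nat := choice.pickle (Num.floor (y / e)).
pose ctr (k : nat) : R :=
  if (pickle_inv k : option int) is Some m then m%:~R * e else 0.
have mcell k : measurable (idx @^-1` [set k]).
  case Ek : (pickle_inv k : option int) => [m|]; last first.
    rewrite (_ : _ @^-1` _ = set0) //; apply/seteqP; split=> // y /= yk.
    by move: Ek; rewrite -yk pickleK_inv.
  rewrite (_ : _ @^-1` _ = [set` `[m%:~R * e, (m + 1)%:~R * e[ ]) //.
  apply/seteqP; split=> y /=; rewrite in_itv /= -ler_pdivlMr // -ltr_pdivrMr //.
    move=> yk; move: Ek; rewrite -yk pickleK_inv => -[<-]; exact: floor_itv.
  move=> /floor_def fy; rewrite /idx fy.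
  by have := @pickle_invK int k; rewrite /ocancel Ek.
have mpre (f : T -> R) B :
    measurable_fun setT f -> measurable B -> measurable (f @^-1` B).
  by move=> mf mB; rewrite -[X in measurable X]setTI; exact: mf.
have mball a r : measurable [set y : R | `|y - a| <= r].
  by apply: measurable_set_ler => //; apply: measurableT_comp => //;
    exact: measurable_funB.
have ctr_close y : `|y - ctr (idx y)| <= e.
  rewrite /ctr /idx pickleK_inv ger0_norm; last first.
    by rewrite subr_ge0 -ler_pdivlMr // floor_le.
  have /andP[_] := floor_itv (y / e).
  by rewrite ltr_pdivrMr // intrD mulrDl mul1r => /ltW; rewrite lerBlDl.
pose F k := (x @^-1` [set y | `|y - ctr k| <= 2 * e]) `&`
  (Z @^-1` (idx @^-1` [set k])).
apply: (@le_trans _ _ (\sum_(0 <= k <oo) P (F k))%E).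
  apply: measure_sigma_subadditive => [k||w /= le_e].
  - by apply: measurableI; apply: mpre.
  - apply: measurable_set_ler => //; apply: measurableT_comp => //.
    exact: measurable_funB.
  - exists (idx (Z w)) => //; split => //=.
    rewrite (_ : x w - _ = (x w - Z w) + (Z w - ctr (idx (Z w)))); last by ring.
    by rewrite (le_trans (ler_normD _ _)) // mulr2n mulrDl mul1r lerD.
apply: (@le_trans _ _ (\sum_(0 <= k <oo) (q%:E * P (Z @^-1` (idx @^-1` [set k]))))%E).
  apply: lee_nneseries => [//|k _]; rewrite indxZ //.
  exact: lee_wpmul2r (ball_le _).
rewrite nneseriesZl // -[leRHS]mule1 lee_wpmul2l //.
set C := fun k : nat => Z @^-1` (idx @^-1` [set k]).
have mC k : measurable (C k) by exact: mpre.
have -> : (\sum_(0 <= k <oo) P (C k) = P (\bigcup_(k in setT) C k))%E.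
  rewrite measure_bigcup //; last first.
    by apply/trivIsetP => i j _ _ /eqP ij; rewrite -subset0 => w [/= iw jw]; apply: ij; rewrite -iw -jw.
  by apply: eq_eseriesl => k; rewrite in_setT.
by apply: probability_le1; exact: bigcup_measurable.
Qed.

End Independence.

(** * Small balls for multi-affine polynomials *)

Section MeasurableBig.
Context (d : measure_display) (T : measurableType d) (R : realType).

Lemma measurable_sum_cond (I : Type) (s : seq I) (Q : pred I) (h : I -> T -> R) :
  (forall i, Q i -> measurable_fun setT (h i)) ->
  measurable_fun setT (fun w => \sum_(i <- s | Q i) h i w).
Proof.
move=> mh; have -> : (fun w => \sum_(i <- s | Q i) h i w) =
    (fun w => \sum_(i <- s) if Q i then h i w else 0).
  by apply/funext => w; rewrite [LHS]big_mkcond.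
apply: measurable_sum => i; case Qi: (Q i); [exact: mh | exact: measurable_cst].
Qed.

Lemma measurable_prod_cond (I : eqType) (s : seq I) (Q : pred I)
    (h : I -> T -> R) :
  (forall i, Q i -> measurable_fun setT (h i)) ->
  measurable_fun setT (fun w => \prod_(i <- s | Q i) h i w).
Proof.
move=> mh; have -> : (fun w => \prod_(i <- s | Q i) h i w) =
    (fun w => \prod_(i <- s) if Q i then h i w else 1).
  by apply/funext => w; rewrite [LHS]big_mkcond.
apply: measurable_prod => i _; case Qi: (Q i); [exact: mh | exact: measurable_cst].
Qed.
End MeasurableBig.

Section MultiAffine.
Context (d : measure_display) (T : measurableType d) (R : realType)
  (P : probability T R).

Lemma measurable_fun_generated (G : set (set T)) (f : T -> R) :
  G `<=` measurable ->
  measurable_fun setT (f : g_sigma_algebraType G -> R) -> measurable_fun setT f.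
Proof.
move=> mG mf mT B mB; have := mf measurableT B mB.
by apply: smallest_sub => //; exact: sigma_algebra_measurable.
Qed.

Variables (U : finType) (x : U -> T -> R) (c : {set U} -> T -> R).

(** The derivative of the polynomial with coefficients [c] with respect to all
    the variables in [L]. *)
Definition affine_part (L : {set U}) (w : T) : R :=
  \sum_(S : {set U} | L \subset S) c S w * \prod_(u in S :\: L) x u w.

Definition affine_rest (u : U) (L : {set U}) (w : T) : R :=
  \sum_(S : {set U} | (L \subset S) && (u \notin S))
    c S w * \prod_(v in S :\: L) x v w.

Lemma affine_part_split (u : U) (L : {set U}) (w : T) : u \notin L ->
  affine_part L w = x u w * affine_part (u |: L) w + affine_rest u L w.
Proof.
move=> uL; rewrite /affine_part (bigID (fun S : {set U} => u \in S)) /=.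
congr (_ + _); rewrite big_distrr /=; apply: eq_big => [S|S /andP[LS uS]].
  by rewrite finset.subUset finset.sub1set andbC.
rewrite (big_setD1 u) /=; last by rewrite finset.in_setD uL.
by rewrite finset.setDDl finset.setUC mulrCA.
Qed.

Lemma affine_part_top (S0 : {set U}) (w : T) :
  (forall S : {set U}, S0 \proper S -> c S w = 0) ->
  affine_part S0 w = c S0 w.
Proof.
move=> c0; rewrite /affine_part (bigD1 S0) //= [X in _ + X]big1 => [|S].
  by rewrite addr0 big_pred0 ?mulr1 // => u; rewrite finset.in_setD andNb.
by move=> /andP[S0S neqS]; rewrite c0 ?mul0r // finset.properEneq S0S eq_sym neqS.
Qed.

Section Measurability.
Context (d' : measure_display) (T' : measurableType d').
Variable pi : T' -> T.
Hypothesis mc : forall S, measurable_fun setT (c S \o pi).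

Lemma measurable_affine_part (L : {set U}) :
  (forall v, v \notin L -> measurable_fun setT (x v \o pi)) ->
  measurable_fun setT (affine_part L \o pi).
Proof.
move=> mx; apply: measurable_sum_cond => S _.
apply: measurable_funM; first exact: mc.
by apply: measurable_prod_cond => v; rewrite finset.in_setD => /andP[vL _]; exact: mx.
Qed.

Lemma measurable_affine_rest (u : U) (L : {set U}) :
  (forall v, v != u -> measurable_fun setT (x v \o pi)) ->
  measurable_fun setT (affine_rest u L \o pi).
Proof.
move=> mx; apply: measurable_sum_cond => S /andP[_ uS].
apply: measurable_funM; first exact: mc.
apply: measurable_prod_cond => v; rewrite finset.in_setD => /andP[_ vS].
by apply: mx; apply: contraNneq uS => <-.
Qed.
End Measurability.

Hypothesis mx : forall u, measurable_fun setT (x u).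
Hypothesis mc : forall S, measurable_fun setT (c S).
Hypothesis indx : forall u, exists G : set (set T),
  [/\ G `<=` measurable,
      forall S, measurable_fun setT (c S : g_sigma_algebraType G -> R),
      forall v, v != u -> measurable_fun setT (x v : g_sigma_algebraType G -> R)
    & forall A C, measurable A -> <<s G >> C ->
        P ((x u @^-1` A) `&` C) = (P (x u @^-1` A) * P C)%E].
Variables (e q : R).
Hypothesis e0 : 0 < e.
Hypothesis ball_le :
  forall u a, (P [set w | `|x u w - a| <= 2 * e]%R <= q%:E)%E.

(** The affine form x g + h is smaller than e |g| only if x lies within e of
    - h / g, which is independent of x. *)
Lemma affine_small_ball (g h : T -> R) (u : U) (G : set (set T)) :
  G `<=` measurable ->
  measurable_fun setT (g : g_sigma_algebraType G -> R) ->
  measurable_fun setT (h : g_sigma_algebraType G -> R) ->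
  (forall A C, measurable A -> <<s G >> C ->
        P ((x u @^-1` A) `&` C) = (P (x u @^-1` A) * P C)%E) ->
  (P [set w | `|x u w * g w + h w| < e * `|g w| ]%R <= q%:E)%E.
Proof.
move=> mG mgG mhG indG.
(* Z = - h / g where g != 0, written with a real power to be visibly
   measurable. *)
pose Z w := - (h w * g w * (g w ^+ 2) `^ (-1)).
have mZG : measurable_fun setT (Z : g_sigma_algebraType G -> R).
  apply: measurableT_comp => //; apply: measurable_funM.
    exact: measurable_funM.
  apply: (@measurableT_comp _ _ _ _ _ _ (fun y : R => y `^ (-1))).
    exact: measurable_powR.
  exact: measurable_funX.
have mg := measurable_fun_generated mG mgG.
have mh := measurable_fun_generated mG mhG.
have mZ := measurable_fun_generated mG mZG.
apply: (@le_trans _ _ (P [set w | `|x u w - Z w| <= e]%R)).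
  apply: le_measure; rewrite ?inE.
  - apply: measurable_set_ltr.
      apply: measurableT_comp => //.
      by apply: measurable_funD => //; exact: measurable_funM.
    by apply: measurable_funM => //; exact: measurableT_comp.
  - by apply: measurable_set_ler => //; apply: measurableT_comp => //;
      exact: measurable_funB.
  move=> w /= lt_g; have g0 : g w != 0.
    by apply: contraTneq lt_g => ->; rewrite normr0 !mulr0 -leNgt normr_ge0.
  have -> : x u w - Z w = (x u w * g w + h w) / g w.
    by rewrite /Z powR_inv1 ?sqr_ge0 //; field.
  by rewrite normrM normfV ler_pdivrMr ?normr_gt0 // ltW.
apply: small_ball_independent => // A B mA mB; apply: indG => //.
by have := mZG measurableT _ mB; rewrite setTI.
Qed.

(** Induction on the variables of [S0] outside [L]: differentiating with respect
    to one of them loses at most a factor e outside an event of probability q,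
    and after the last one only the coefficient of [S0] is left, since no larger
    monomial occurs.  The strict inequality makes the event empty there. *)
Lemma multi_affine_small_ball (S0 L : {set U}) :
  (forall (S : {set U}) w, S0 \proper S -> c S w = 0) -> L \subset S0 ->
  (P [set w | `|affine_part L w| < e ^+ #|S0 :\: L| * `|c S0 w| ]%R <=
   (#|S0 :\: L|%:R * q)%:E)%E.
Proof.
move=> c0; move En : #|_| => n; elim: n L En => [|n IHn] L card_L sub_L.
  have -> : L = S0.
    apply/eqP; rewrite finset.eqEsubset sub_L /= -finset.setD_eq0.
    by rewrite -cards_eq0 card_L.
  rewrite (_ : [set _ | _] = set0) ?measure0 ?mul0r //.
  apply/seteqP; split=> // w /=; rewrite expr0 mul1r affine_part_top ?ltxx //.
  by move=> S; exact: c0.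
have [u] : exists u, u \in S0 :\: L by apply/finset.set0Pn; rewrite -cards_eq0 card_L.
rewrite finset.in_setD => /andP[uL uS0].
have [G [mG cG xG indG]] := indx u.
pose L' := u |: L.
pose A := [set w | `|affine_part L' w| < e ^+ n * `|c S0 w| ].
pose B := [set w | `|x u w * affine_part L' w + affine_rest u L w| <
  e * `|affine_part L' w| ].
have mp K : measurable_fun setT (affine_part K).
  by apply: (@measurable_affine_part _ _ id) => // v _; exact: mx.
have mr K : measurable_fun setT (affine_rest u K).
  by apply: (@measurable_affine_rest _ _ id) => // v _; exact: mx.
have mlt K k : measurable [set w | `|affine_part K w| < e ^+ k * `|c S0 w| ].
  apply: measurable_set_ltr; first exact: measurableT_comp.
  by apply: measurable_funM => //; exact: measurableT_comp.
have mB : measurable B.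
  apply: measurable_set_ltr.
    apply: measurableT_comp => //; apply: measurable_funD => //.
    exact: measurable_funM.
  by apply: measurable_funM => //; exact: measurableT_comp.
have subAB : [set w | `|affine_part L w| < e ^+ n.+1 * `|c S0 w| ] `<=` A `|` B.
  move=> w /= lt_w; rewrite /A /B /= -affine_part_split //.
  have [?|ge_w] := ltP `|affine_part L' w| (e ^+ n * `|c S0 w|); first by left.
  right; rewrite (lt_le_trans lt_w) // exprS -mulrA ler_wpM2l // ltW //.
apply: (le_trans (le_measure P _ _ subAB)); rewrite ?inE //.
  by apply: measurableU => //; exact: mlt.
apply: (le_trans (measureU2 _ _ _)) => //; first exact: mlt.
rewrite -natr1 mulrDl mul1r EFinD leeD //.
  apply: IHn; last by rewrite finset.subUset finset.sub1set uS0.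
  have := cardsD1 u (S0 :\: L); rewrite finset.in_setD uL uS0 card_L add1n => -[->].
  by rewrite /L' finset.setDDl finset.setUC.
apply: affine_small_ball mG _ _ indG.
  apply: (@measurable_affine_part _ (g_sigma_algebraType G) id) => // v.
  by rewrite finset.in_setU1 negb_or => /andP[vu _]; exact: xG.
exact: (@measurable_affine_rest _ (g_sigma_algebraType G) id).
Qed.

End MultiAffine.

(** * Moments, tails and almost sure events *)

Section Moments.
Context (d : measure_display) (T : measurableType d) (R : realType)
  (P : probability T R).

Lemma markov_set (g : T -> R) (A : set T) (c : R) :
  measurable_fun setT g -> (forall w, 0 <= g w) -> measurable A -> 0 <= c ->
  (forall w, A w -> c <= g w) -> (c%:E * P A <= 'E_P[g])%E.
Proof.
move=> mg g0 mA c0 le_cg; rewrite -integral_cst // unlock.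
apply: (@le_trans _ _ (\int[P]_(w in A) (g w)%:E)%E).
  apply: ge0_le_integral => //=.
  by apply/measurable_EFinP; exact: measurable_funS mg.
apply: ge0_subset_integral => //; first exact/measurable_EFinP.
by move=> w _; rewrite lee_fin.
Qed.

(** Markov's inequality for |xi - a|^(- tau). *)
Lemma small_ball_of_moment (xi : T -> R) (tau K : R) :
  measurable_fun setT xi -> atomless P xi -> 0 < tau ->
  (forall a, ('E_P[(fun w => `|xi w - a| `^ (- tau))%R] <= K%:E)%E) ->
  forall a r, 0 < r ->
    (P [set w | `|xi w - a| <= r]%R <= (K * r `^ tau)%:E)%E.
Proof.
move=> mxi xi0 tau0 leK a r r0.
have mdist : measurable_fun setT (fun w => `|xi w - a|).
  by apply: measurableT_comp => //; exact: measurable_funB.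
(* The point xi = a has to be removed, the power being 0 there. *)
pose A := [set w | 0 < `|xi w - a|] `&` [set w | `|xi w - a| <= r].
have mA : measurable A.
  by apply: measurableI; [exact: measurable_set_ltr | exact: measurable_set_ler].
have m_eq : measurable (xi @^-1` [set a]).
  by rewrite -[X in measurable X]setTI; apply: mxi.
apply: (@le_trans _ _ (P A)).
  apply: (@le_trans _ _ (P (A `|` xi @^-1` [set a]))).
    apply: le_measure; rewrite ?inE; [exact: measurable_set_ler|exact: measurableU|].
    move=> w /= le_r; have [->|neq] := eqVneq (xi w) a; first by right.
    by left; split=> //=; rewrite normr_gt0 subr_eq0.
  apply: (le_trans (measureU2 _ _ _)) => //.
  by rewrite [X in (_ + X)%E](xi0 a) adde0.
have rt0 : 0 < r `^ (- tau) by rewrite powR_gt0.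
have : ((r `^ (- tau))%:E * P A <= K%:E)%E.
  apply: le_trans (leK a); apply: markov_set => //; last first.
    move=> w [/= pos le_r]; rewrite !powRN lef_pV2 ?posrE ?powR_gt0 //.
    by rewrite ge0_ler_powR ?nnegrE ?(ltW tau0) ?(ltW r0) ?(ltW pos).
    exact: powR_ge0.
  exact: (@measurableT_comp _ _ _ _ _ _ (fun y : R => y `^ (- tau))).
have -> : P A = (fine (P A))%:E by rewrite fineK // fin_num_measure.
by rewrite -EFinM !lee_fin powRN mulrC ler_pdivrMr ?powR_gt0.
Qed.

Lemma tail_of_moment (xi : T -> R) (tau K : R) :
  measurable_fun setT xi -> 0 < tau ->
  ('E_P[(fun w => `|xi w| `^ tau)%R] <= K%:E)%E ->
  forall r, 0 < r ->
    (P [set w | r^-1 < `|xi w| ]%R <= (K * r `^ tau)%:E)%E.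
Proof.
move=> mxi tau0 leK r r0; set A := [set w | _].
have mnorm : measurable_fun setT (fun w => `|xi w|) by exact: measurableT_comp.
have mA : measurable A by exact: measurable_set_ltr.
have H : ((r^-1 `^ tau)%:E * P A <= K%:E)%E.
  apply: le_trans leK; apply: markov_set => //; last first.
    move=> w /= lt_r; apply: ge0_ler_powR; rewrite ?nnegrE ?invr_ge0 ?(ltW tau0) //.
      exact: ltW.
    exact: ltW.
    exact: powR_ge0.
  exact: (@measurableT_comp _ _ _ _ _ _ (fun y : R => y `^ tau)).
move: H; have -> : P A = (fine (P A))%:E by rewrite fineK // fin_num_measure.
rewrite -EFinM !lee_fin -powR_inv1 ?(ltW r0) // -powRrM mulN1r powRN.
by rewrite mulrC ler_pdivrMr ?powR_gt0.
Qed.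

Lemma sum_inv_sqr_le (n : nat) :
  \sum_(k < n) (k.+1%:R ^+ 2)^-1 <= 2 :> R.
Proof.
case: n => [|n]; first by rewrite big_ord0.
(* The bound 1 / (k + 1)^2 <= 1 / k - 1 / (k + 1) telescopes. *)
suff : \sum_(k < n.+1) (k.+1%:R ^+ 2)^-1 <= 2 - n.+1%:R^-1 :> R.
  by move=> /le_trans; apply; rewrite gerBl.
elim: n => [|n IHn]; first by rewrite big_ord_recr big_ord0 /= add0r expr1n !invr1; lra.
rewrite big_ord_recr /=; apply: le_trans (lerD IHn (lexx _)) _.
have : (1 : R) <= n.+1%:R by rewrite ler1n.
rewrite -[n.+2%:R]natr1; move: (n.+1%:R) => x x1.
have x_gt0 : 0 < x by exact: lt_le_trans x1.
have x0 : x != 0 by rewrite gt_eqF.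
have x10 : x + 1 != 0 by rewrite gt_eqF // addr_gt0.
rewrite -subr_ge0.
have -> : 2 - (x + 1)^-1 - (2 - x^-1 + ((x + 1) ^+ 2)^-1) =
    (x * (x + 1) ^+ 2)^-1 by field; rewrite x10 x0.
by rewrite invr_ge0 mulr_ge0 ?sqr_ge0 ?ltW.
Qed.

Lemma borel_cantelli_inv_sqr (B : nat -> set T) (K : R) :
  (forall n, measurable (B n)) ->
  (forall n, (P (B n) <= (K * (n.+1%:R ^+ 2)^-1)%:E)%E) ->
  \forall w \ae P, \forall n \near \oo, ~ B n w.
Proof.
move=> mB le_B.
have K0 : 0 <= K.
  have := le_trans (measure_ge0 P (B 0)) (le_B 0).
  by rewrite lee_fin expr1n invr1 mulr1.
have sumB : (\sum_(0 <= n <oo) P (B n) < +oo)%E.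
  apply: (@le_lt_trans _ _ (K * 2)%:E); last exact: ltry.
  apply: lime_le; first exact: is_cvg_nneseries.
  apply: nearW => n.
  apply: (@le_trans _ _ (\sum_(0 <= k < n) (K * (k.+1%:R ^+ 2)^-1)%:E)%E).
    by apply: lee_sum => k _; exact: le_B.
  by rewrite sumEFin lee_fin -mulr_sumr ler_wpM2l // big_mkord sum_inv_sqr_le.
exists (lim_sup_set B); split.
- by apply: bigcapT_measurable => n; exact: bigcup_measurable.
- exact: lim_sup_set_cvg0.
move=> w /= nB n _; apply: contrapT => nBn; apply: nB.
exists n => // k /= le_nk Bk; apply: nBn; by exists k.
Qed.

End Moments.

(** * Logarithms against powers *)

Lemma cvg_inv_powR (R : realType) (s : R) : 0 < s ->
  (fun n : nat => (n.+1%:R `^ s)^-1 : R) @ \oo --> (0 : R).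
Proof.
move=> s0; apply/cvgrPdist_lt => eps eps0.
near=> n; rewrite sub0r normrN ger0_norm ?invr_ge0 ?powR_ge0 //.
rewrite invf_plt ?posrE ?powR_gt0 //.
have -> : eps^-1 = (eps^-1 `^ s^-1) `^ s.
  by rewrite -powRrM mulVf ?gt_eqF // powRr1 // invr_ge0 ltW.
apply: gt0_ltr_powR; rewrite ?nnegrE ?powR_ge0 //.
near: n; exists (Num.truncn (eps^-1 `^ s^-1)) => // n /= le_n.
by rewrite (lt_le_trans (truncnS_gt _)) // ler_nat.
Unshelve. all: by end_near. Qed.

Lemma ln_le_powR (R : realType) (x s : R) : 0 < x -> 0 < s ->
  ln x <= s^-1 * x `^ s.
Proof.
move=> x0 s0; have := ltW (ln_sublinear (powR_gt0 s x0)).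
by rewrite ln_powR -ler_pdivlMl.
Qed.

Lemma cvg_log_over_powR (R : realType) (y : nat -> R) (K1 K2 r : R) :
  0 < r -> 0 <= K1 -> 0 <= K2 ->
  (\forall n \near \oo, `|y n.+1| <= K1 + K2 * ln n.+1%:R) ->
  (fun n => y n / n%:R `^ r) @ \oo --> (0 : R).
Proof.
move=> r0 K10 K20 le_y; rewrite -cvg_shiftS /=.
(* Half of the power absorbs the logarithm, the other half tends to 0. *)
pose s := r / 2; have s0 : 0 < s by rewrite divr_gt0.
pose z := fun n : nat => (K1 + K2 * s^-1) * (n.+1%:R `^ s)^-1 : R.
have z0 : z @ \oo --> (0 : R).
  rewrite -[0](mulr0 (K1 + K2 * s^-1)); apply: cvgMr; exact: cvg_inv_powR.
have zN0 : (fun n => - z n) @ \oo --> (0 : R) by rewrite -oppr0; apply: cvgN.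
apply: (squeeze_cvgr _ zN0 z0); near=> n.
rewrite -ler_norml normrM normfV (ger0_norm (powR_ge0 _ _)).
have n1 : 1 <= n.+1%:R :> R by rewrite ler1n.
have n0 : 0 < n.+1%:R :> R by rewrite ltr0n.
have -> : n.+1%:R `^ r = n.+1%:R `^ s * n.+1%:R `^ s :> R.
  by rewrite -powRD ?gt_eqF ?implybT // /s -splitr.
have p0 : 0 < n.+1%:R `^ s :> R by rewrite powR_gt0.
rewrite invfM mulrA ler_wpM2r ?invr_ge0 ?powR_ge0 // ler_pdivrMr //.
have /le_trans -> // : `|y n.+1| <= K1 + K2 * ln n.+1%:R by near: n.
rewrite mulrDl lerD //.
  by rewrite ler_peMr //; have := ler_powR n1 (ltW s0); rewrite powRr0.
by rewrite -mulrA ler_wpM2l // ln_le_powR.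
Unshelve. all: by end_near. Qed.

(** * Random matrix products *)

Section EntryMeasurability.
Context (disp : measure_display) (T : measurableType disp) (R : realType)
  (d : nat).

Lemma measurable_minor (p : nat) (f g : 'I_p -> 'I_d) (A : T -> 'M[R]_d) :
  (forall i j, measurable_fun setT (fun w => A w i j)) ->
  measurable_fun setT (fun w => minor f g (A w)).
Proof.
move=> mA; apply: measurable_sum => s; apply: measurable_funM => //.
apply: measurable_prod => i _.
by under eq_fun do rewrite mxE; exact: mA.
Qed.

Lemma measurable_minor_coef (p : nat) (S : {set 'I_d * 'I_d}) (A : T -> 'M[R]_d) :
  (forall i j, measurable_fun setT (fun w => A w i j)) ->
  measurable_fun setT (fun w => minor_coef p (A w) S).
Proof. by move=> mA; apply: measurable_sum_cond => fg _; exact: measurable_minor. Qed.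

Lemma measurable_mx_product (X : nat -> T -> 'M[R]_d) (n : nat) :
  (forall k, (k < n)%N -> forall i j, measurable_fun setT (fun w => X k w i j)) ->
  forall i j, measurable_fun setT (fun w => mx_product (fun k => X k w) n i j).
Proof.
elim: n => [|n IHn] mX i j; first exact: measurable_cst.
rewrite /=; under eq_fun do rewrite mxE.
apply: measurable_sum => k; apply: measurable_funM; first exact: mX.
by apply: IHn => l lt_ln; apply: mX; exact: ltnW.
Qed.
End EntryMeasurability.

Section Products.
Context (disp : measure_display) (T : measurableType disp) (R : realType)
  (P : probability T R) (d : nat) (X : nat -> {RV P >-> 'M[R]_d}).

Local Notation entry n u := (fun w => X n w u.1 u.2).

Lemma measurable_RV_entry (n : nat) (i j : 'I_d) :
  measurable_fun setT (fun w => X n w i j).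
Proof. exact: (measurableT_comp (measurable_entry i j)). Qed.

Hypothesis X_indep : mutually_independent P (fun n w => X n w).
Hypothesis entries_indep : forall n,
  mutually_independent P (fun (ij : 'I_d * 'I_d) w => X n w ij.1 ij.2).

Definition past_index (n : nat) : {fset nat} := [fset k in iota 0 n]%fset.
Definition other_index (u : 'I_d * 'I_d) : {fset 'I_d * 'I_d} :=
  [fset v in enum (predC1 u)]%fset.

Definition past_event (n : nat) (B : nat -> set 'M[R]_d) : set T :=
  \bigcap_(k in [set` past_index n]) (X k @^-1` B k).
Definition others_box (u : 'I_d * 'I_d) (D : 'I_d * 'I_d -> set R) : set 'M[R]_d :=
  \bigcap_(v in [set` other_index u]) ((fun A : 'M[R]_d => A v.1 v.2) @^-1` D v).

(** Independence is only given on rectangles; these rectangles form a pi-system,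
    which makes it extend to the sigma-algebra they generate. *)
Definition rest_generators (n : nat) (u : 'I_d * 'I_d) : set (set T) :=
  [set C | exists B D, [/\ forall k, measurable (B k), forall v, measurable (D v)
    & C = past_event n B `&` (X n @^-1` others_box u D)]].

Lemma measurable_preimage_RV (n : nat) (B : set 'M[R]_d) :
  measurable B -> measurable (X n @^-1` B).
Proof.
move=> mB; rewrite -[X in measurable X]setTI.
exact: (measurable_funPT (X n)).
Qed.

Lemma measurable_past_event n B : (forall k, measurable (B k)) ->
  measurable (past_event n B).
Proof.
move=> mB; apply: fin_bigcap_measurable => [|k _]; first exact: finite_fset.
exact: measurable_preimage_RV.
Qed.

Lemma measurable_entry_preimage (v : 'I_d * 'I_d) (D : set R) : measurable D ->
  measurable ((fun A : 'M[R]_d => A v.1 v.2) @^-1` D).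
Proof.
move=> mD; rewrite -[X in measurable X]setTI.
exact: (measurable_entry v.1 v.2).
Qed.

Lemma measurable_others_box u D : (forall v, measurable (D v)) ->
  measurable (others_box u D).
Proof.
move=> mD; apply: fin_bigcap_measurable => [|k _]; first exact: finite_fset.
exact: measurable_entry_preimage.
Qed.

Lemma rest_generators_measurable n u : rest_generators n u `<=` measurable.
Proof.
move=> _ [B [D [mB mD ->]]]; apply: measurableI.
  exact: measurable_past_event.
by apply: measurable_preimage_RV; exact: measurable_others_box.
Qed.

Lemma rest_generatorsT n u : rest_generators n u setT.
Proof.
exists (fun=> setT), (fun=> setT); split=> //.
by apply/esym/seteqP; split=> // w _; split=> // k _.
Qed.

Lemma rest_generators_setI n u : setI_closed (rest_generators n u).
Proof.
move=> _ _ [B [D [mB mD ->]]] [B' [D' [mB' mD' ->]]].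
exists (fun k => B k `&` B' k), (fun v => D v `&` D' v); split.
- by move=> k; exact: measurableI.
- by move=> v; exact: measurableI.
apply/seteqP; split=> w /=.
  move=> [[h1 h2] [h3 h4]]; split=> k Jk.
    by split; [exact: h1 | exact: h3].
  by split; [exact: h2 | exact: h4].
move=> [h1 h2]; do ![split] => k Jk.
- by have [] := h1 _ Jk.
- by have [] := h2 _ Jk.
- by have [] := h1 _ Jk.
- by have [] := h2 _ Jk.
Qed.

(** On the generators the probability factorizes twice: over the matrices, then
    over the entries of the [n]-th one. *)
Lemma entry_independent_rest n u (A : set R) (C : set T) : measurable A ->
  <<s rest_generators n u >> C ->
  P ((entry n u @^-1` A) `&` C) = (P (entry n u @^-1` A) * P C)%E.
Proof.
move=> mA; have mE : measurable (entry n u @^-1` A).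
  have := measurable_preimage_RV n (measurable_entry_preimage u mA).
  by rewrite -comp_preimage.
apply: independent_generated => //.
- exact: rest_generators_measurable.
- exact: rest_generators_setI.
- exact: rest_generatorsT.
move=> _ [B [D [mB mD ->]]].
have n_past : n \notin past_index n by rewrite !inE mem_iota ltnn andbF.
have u_others : u \notin other_index u by rewrite !inE mem_enum !inE eqxx.
have split_past V : measurable V ->
    P ((X n @^-1` V) `&` past_event n B) = (P (X n @^-1` V) * P (past_event n B))%E.
  by move=> mV; exact: (independent_split X_indep).
have split_entry : P (X n @^-1` ((fun M : 'M[R]_d => M u.1 u.2) @^-1` A `&` others_box u D)) =
    (P (entry n u @^-1` A) * P (X n @^-1` others_box u D))%E.
  exact: (independent_split (entries_indep n)).
have mbox := measurable_others_box u mD.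
rewrite [past_event n B `&` _]setIC split_past // muleA -split_entry -split_past.
  by congr (P _); rewrite setIA.
apply: measurableI => //; exact: measurable_entry_preimage.
Qed.

(** A single entry is measured by the generator that leaves the other factors
    unconstrained. *)
Lemma measurable_past_entry n u k i j : (k < n)%N ->
  measurable_fun setT
    ((fun w => X k w i j) : g_sigma_algebraType (rest_generators n u) -> R).
Proof.
move=> lt_kn _ B mB; rewrite setTI; apply: sub_sigma_algebra.
exists (fun l => if l == k then (fun A : 'M[R]_d => A i j) @^-1` B else setT).
exists (fun=> setT); split=> [l||].
- by case: ifP => // _; exact: (measurable_entry_preimage (i, j)).
- by move=> v.
apply/seteqP; split=> w /=; rewrite /past_event /=.
  by move=> Bw; split=> [l _|v _] //=; case: eqP => // ->.
move=> [/(_ k) + _]; rewrite /= eqxx; apply.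
by rewrite !inE mem_iota.
Qed.

Lemma measurable_other_entry n u v : v != u ->
  measurable_fun setT (entry n v : g_sigma_algebraType (rest_generators n u) -> R).
Proof.
move=> vu _ B mB; rewrite setTI; apply: sub_sigma_algebra.
exists (fun=> setT), (fun v' => if v' == v then B else setT); split=> [||].
- by move=> k.
- by move=> v'; case: ifP.
apply/seteqP; split=> w /=.
  by move=> Bw; split=> [l _|v' _] //=; case: eqP => // ->.
move=> [_ /(_ v)]; rewrite /= eqxx; apply.
by rewrite !inE mem_enum !inE.
Qed.

Variables (e q : R).
Hypothesis e0 : 0 < e.
Hypothesis q0 : 0 <= q.
Hypothesis ball_le : forall n i j a,
  (P [set w | `|X n w i j - a| <= 2 * e]%R <= q%:E)%E.

(** The multi-affine bound with the entries of the newest factor as variables and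
    the minors of the older product in the coefficients.  If f or g is not
    injective the minor is 0 and the event is empty. *)
Lemma minor_sum_small_ball (n p : nat) (f g : {ffun 'I_p -> 'I_d}) :
  (P [set w | `|minor_sum p (mx_product (fun k => X k w) n.+1)| <
     e ^+ p * `|minor f g (mx_product (fun k => X k w) n)| ]%R <=
   (p%:R * q)%:E)%E.
Proof.
pose M m w := mx_product (fun k => X k w) m.
have mM m i j : measurable_fun setT (fun w => M m w i j).
  by apply: measurable_mx_product => k _ *; exact: measurable_RV_entry.
set E := [set w | _].
have [f_inj|f_ninj] := boolP (injectiveb f); last first.
  rewrite (_ : E = set0) ?measure0 ?lee_fin ?mulr_ge0 //.
  apply/seteqP; split=> // w; rewrite /E /= minor_not_inj //.
  by rewrite normr0 mulr0 ltNge normr_ge0.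
have [/injectiveP g_inj|g_ninj] := boolP (injectiveb g); last first.
  rewrite (_ : E = set0) ?measure0 ?lee_fin ?mulr_ge0 //.
  apply/seteqP; split=> // w; rewrite /E /= -minor_tr minor_not_inj //.
  by rewrite normr0 mulr0 ltNge normr_ge0.
pose c S w := minor_coef p (M n w) S.
have mc S : measurable_fun setT (c S) by exact: measurable_minor_coef.
have small := @multi_affine_small_ball _ T R P _ (fun u => entry n u) c
  (fun u => measurable_RV_entry n u.1 u.2) mc _ e q e0 _ (positions g f) finset.set0.
have card_S0 : #|positions g f :\: finset.set0| = p.
  by rewrite finset.setD0 card_positions.
apply: le_trans (le_trans (small _ _ _ _) _); last first.
- by rewrite card_S0.
- exact: finset.sub0set.
- by move=> S w; exact: minor_coef_proper.
- by move=> u a; exact: ball_le.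
- move=> u; exists (rest_generators n u); split.
  + exact: rest_generators_measurable.
  + move=> S; apply: measurable_minor_coef => i j.
    apply: measurable_mx_product => k lt_kn i' j'; exact: measurable_past_entry.
  + by move=> v vu; exact: measurable_other_entry.
  + by move=> A C; exact: entry_independent_rest.
rewrite card_S0; apply: le_measure; rewrite ?inE.
- apply: measurable_set_ltr.
    apply: measurableT_comp => //; apply: measurable_sum => h.
    by apply: measurable_minor => i j; exact: (mM n.+1).
  apply: measurable_funM => //; apply: measurableT_comp => //.
  by apply: measurable_minor => i j; exact: (mM n).
- apply: measurable_set_ltr.
    apply: measurableT_comp => //.
    by apply: (@measurable_affine_part _ _ _ _ _ _ _ _ id) => // u _; exact: measurable_RV_entry.
  by apply: measurable_funM => //; exact: measurableT_comp.
move=> w; rewrite /E /= minor_sum_multi_affine /affine_part => lt_w.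
under eq_bigl do rewrite finset.sub0set.
under eq_bigr do rewrite finset.setD0.
by apply: lt_le_trans lt_w _; rewrite ler_wpM2l ?exprn_ge0 ?(ltW e0) // minor_le_coef.
Qed.

End Products.

(** * The theorem *)

Theorem corollary25 (R : realType) (disp : measure_display)
  (T : measurableType disp) (P : probability T R) (d : nat)
  (xi : {RV P >-> R})
  (xi_atomless : atomless P xi)
  (xi_support : exists U : set R,
     [/\ open U, U !=set0 & U `<=` law_support P xi])
  (xi_moments : exists tau : R,
     [/\ 0 < tau,
         ('E_P[(fun w => `|xi w| `^ tau)%R] < +oo)%E
       & (ereal_sup (range (fun a : R => 'E_P[(fun w => `|xi w - a| `^ (- tau))%R]))
            < +oo)%E])
  (X : nat -> {RV P >-> 'M[R]_d})
  (X_iid : iid P (fun n w => X n w))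
  (entries_iid : forall n : nat,
     iid P (fun (ij : 'I_d * 'I_d) w => X n w ij.1 ij.2))
  (entries_law : forall (n : nat) (i j : 'I_d),
     same_law P (fun w => X n w i j) xi) :
  forall r : R, 0 < r ->
    \forall w \ae P, forall p : 'I_d,
      (fun n : nat =>
         let M := mx_product (fun k => X k w) n in
         ln (modulus (nth 0 (eigenvalues M) p) / nth 0 (singular_values M) p)
           / n%:R `^ r) @ \oo --> (0 : R).
Proof.
move=> r r0; have [tau [tau0 pos_moment neg_moment]] := xi_moments.
have mxi : measurable_fun setT xi by exact: measurable_funPT.
have E_ge0 (g : T -> R) : (forall w, 0 <= g w) -> (0 <= 'E_P[g])%E.
  by move=> g0; rewrite unlock; apply: integral_ge0 => w _; rewrite lee_fin.
pose neg a := ('E_P[(fun w => `|xi w - a| `^ (- tau))%R])%E.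
pose K := fine (ereal_sup (range neg)).
have le_K a : (neg a <= K%:E)%E.
  have le_sup : (neg a <= ereal_sup (range neg))%E by apply: ereal_sup_ubound; exists a.
  by rewrite /K fineK // ge0_fin_numE // (le_trans _ le_sup) // E_ge0.
pose L := fine ('E_P[(fun w => `|xi w| `^ tau)%R])%E.
have le_L : ('E_P[(fun w => `|xi w| `^ tau)%R] <= L%:E)%E.
  by rewrite /L fineK // ge0_fin_numE // E_ge0.
have K0 : 0 <= K.
  by rewrite -lee_fin (le_trans _ (le_K 0)) // E_ge0.
have ball n i j a s : 0 < s ->
    (P [set w | `|X n w i j - a| <= s]%R <= (K * s `^ tau)%:E)%E.
  move=> s0; have := small_ball_of_moment mxi xi_atomless tau0 le_K a s0.
  have /(entries_law n i j) : measurable [set y : R | `|y - a| <= s].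
    by apply: measurable_set_ler => //; apply: measurableT_comp => //;
      exact: measurable_funB.
  by rewrite /preimage /= => ->.
have tail n i j s : 0 < s ->
    (P [set w | s^-1 < `|X n w i j| ]%R <= (L * s `^ tau)%:E)%E.
  move=> s0; have := tail_of_moment mxi tau0 le_L s0.
  have /(entries_law n i j) : measurable [set y : R | s^-1 < `|y| ].
    by apply: measurable_set_ltr => //; apply: measurableT_comp.
  by rewrite /preimage /= => ->.
(* The scale at which all probabilities become summable: e n ^ tau is
   1 / (n + 1)^2, while ln (1 / e n) is only (2 / tau) ln (n + 1). *)
pose e (n : nat) : R := n.+1%:R `^ (- (2 / tau)).
have e0 n : 0 < e n by rewrite powR_gt0.
have e_tau n : e n `^ tau = (n.+1%:R ^+ 2)^-1.
  rewrite -powRrM mulNr divfK ?gt_eqF // powRN.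
  by rewrite -powR_mulrn.
have e_inv n : (e n)^-1 = n.+1%:R `^ (2 / tau) by rewrite /e powRN invrK.
have e1 n : e n <= 1.
  rewrite -invr_ge1 ?posrE // ?unitfE ?gt_eqF // e_inv.
  by rewrite -[leLHS](powRr0 n.+1%:R) ler_powR ?ler1n // divr_ge0 // ltW.
pose M n w := mx_product (fun k => X k w) n.
have mM n i j : measurable_fun setT (fun w => M n w i j).
  by apply: measurable_mx_product => k _ *; exact: measurable_RV_entry.
have mMinor n p (f g : {ffun 'I_p -> 'I_d}) :
    measurable_fun setT (fun w => minor f g (M n w)).
  by apply: measurable_minor => i j; exact: mM.
have minor_big : \forall w \ae P, forall (p : 'I_d.+1) (f g : {ffun 'I_p -> 'I_d}),
    \forall n \near \oo,
      ~ `|minor_sum p (M n.+1 w)| < e n ^+ p * `|minor f g (M n w)|.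
  apply: filter_forall => p; apply: filter_forall => f; apply: filter_forall => g.
  apply: (@borel_cantelli_inv_sqr _ _ _ _ (fun n =>
    [set w | `|minor_sum p (M n.+1 w)| < e n ^+ p * `|minor f g (M n w)| ])
    (p%:R * (K * 2 `^ tau))) => n.
    apply: measurable_set_ltr.
      by apply: measurableT_comp => //; apply: measurable_sum => h.
    by apply: measurable_funM => //; exact: measurableT_comp.
  rewrite -mulrA -mulrA -e_tau -powRM ?(ltW (e0 n)) //.
  apply: minor_sum_small_ball => //.
  - exact: X_iid.1.
  - by move=> k; exact: (entries_iid k).1.
  - by rewrite mulr_ge0 ?powR_ge0.
  - by move=> k i j a; apply: ball; rewrite mulr_gt0.
have entry_small : \forall w \ae P, forall i j : 'I_d,
    \forall n \near \oo, ~ (e n)^-1 < `|X n w i j|.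
  apply: filter_forall => i; apply: filter_forall => j.
  apply: (@borel_cantelli_inv_sqr _ _ _ _ (fun n =>
    [set w | (e n)^-1 < `|X n w i j| ]) L) => n.
    apply: measurable_set_ltr => //; apply: measurableT_comp => //.
    exact: measurable_RV_entry.
  by rewrite -e_tau; exact: tail.
move: minor_big entry_small; apply: filterS2 => w minor_big entry_small p /=.
have d0 : (0 < d)%N by case: (d) p => [[]|].
pose K1 : R := 2 * ln (d ^ (3 * d))%:R.
pose K2 : R := 2 * ((2 * d)%:R * (2 / tau)).
apply: (@cvg_log_over_powR _ _ K1 K2) => //.
- by rewrite mulr_ge0 // ln_ge0 // ler1n expn_gt0 d0.
- by rewrite !mulr_ge0 // invr_ge0 ltW.
have near_minor : \forall n \near \oo, forall (q : 'I_d.+1) (f g : {ffun 'I_q -> 'I_d}),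
    ~ `|minor_sum q (M n.+1 w)| < e n ^+ q * `|minor f g (M n w)|.
  by do 3!apply: filter_forall => ?.
have near_entry : \forall n \near \oo, forall i j, ~ (e n)^-1 < `|X n w i j|.
  by do 2!apply: filter_forall => ?.
near=> n.
have -> : K1 + K2 * ln n.+1%:R =
    2 * (ln (d ^ (3 * d))%:R + (2 * d)%:R * ln (e n)^-1).
  by rewrite e_inv ln_powR /K1 /K2; ring.
have minor_n : forall (q : 'I_d.+1) (f g : {ffun 'I_q -> 'I_d}),
    ~ `|minor_sum q (M n.+1 w)| < e n ^+ q * `|minor f g (M n w)|.
  by near: n; exact: near_minor.
apply: log_ratio_step => // [|i j|q f g le_qd].
- by rewrite e0 e1.
- by rewrite leNgt; apply/negP; move: i j; near: n; exact: near_entry.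
- rewrite leNgt; apply/negP.
  exact: (minor_n (Ordinal (le_qd : (q < d.+1)%N)) f g).
Unshelve. all: by end_near. Qed.
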